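(* Let $\mathbb{G}=(A,\Delta)$ be a compact $C^{*}$-quantum group and let $\delta$ be a counital partial coaction of the discrete dual $\hat{\mathbb{G}}=(\hat A,\hat\Delta)$ on a unital $C^{*}$-algebra $C$. Then the formula $$\upsilon\otimes c\mapsto \upsilon\triangleright c=(\mathrm{id}_C\otimes\upsilon)(\delta(c))\qquad(\upsilon\in\mathcal{O}(\mathbb{G}),\ c\in C)$$ defines a symmetric partial action of the Hopf algebra $\mathcal{O}(\mathbb{G})$ on $C$.
   Context: Tensor products of $C^{*}$-algebras are minimal; $M(A)$ is the multiplier algebra with unit $1_A$. A $C^{*}$-bialgebra is a $C^{*}$-algebra $A$ with a nondegenerate coassociative $*$-homomorphism $\Delta\colon A\to M(A\otimes A)$. A counit is a character $\varepsilon$ on $A$ with $(\varepsilon\otimes\mathrm{id})\Delta=\mathrm{id}=(\mathrm{id}\otimes\varepsilon)\Delta$. A compact $C^{*}$-quantum group is a unital $C^{*}$-bialgebra $\mathbb{G}=(A,\Delta)$ such that $\Delta(A)(1_A\otimes A)$ and $(A\otimes 1_A)\Delta(A)$ are linearly dense in $A\otimes A$. $\mathcal{O}(\mathbb{G})\subseteq A$ is the dense Hopf subalgebra of matrix elements of finite-dimensional unitary corepresentations, and $\mathrm{Irr}(\mathbb{G})$ is the set of equivalence classes of irreducible ones. The discrete dual $\hat{\mathbb{G}}=(\hat A,\hat\Delta)$ is the dual $C^{*}$-bialgebra; $\hat A$ is a $c_0$-direct sum of matrix algebras $\hat A_\alpha$, $\alpha\in\mathrm{Irr}(\mathbb{G})$,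 and $(\hat A,\hat\Delta)$ has a counit. The Hopf algebra $\mathcal{O}(\mathbb{G})$ is identified with the space of all functionals $\omega\in\hat A^{*}$ that vanish on $\hat A_\alpha$ for all but finitely many $\alpha$; under this identification $\Delta(\omega)(\hat a\otimes\hat b)=\omega(\hat a\hat b)$ and $(\upsilon\omega)(\hat a)=(\upsilon\otimes\omega)(\hat\Delta(\hat a))$ for $\upsilon,\omega\in\mathcal{O}(\mathbb{G})$, $\hat a,\hat b\in\hat A$, and the unit of $\mathcal{O}(\mathbb{G})$ is the counit of $\hat A$. A $*$-homomorphism $\pi\colon B\to M(C)$ is strict if it is strictly continuous on the unit ball; it then extends to $M(B)$. A partial coaction of a $C^{*}$-bialgebra $(A,\Delta)$ on a $C^{*}$-algebra $C$ is a strict $*$-homomorphism $\delta\colon C\to M(C\otimes A)$ with $\delta(C)(1_C\otimes A)\subseteq C\otimes A$ and $(\delta\otimes\mathrm{id}_A)\delta(c)=(\delta(1_C)\otimes 1_A)(\mathrm{id}_C\otimes\Delta)\delta(c)$ for all $c\in C$. It is counital if $(A,\Delta)$ has a counit $\varepsilon$ and $(\mathrm{id}_C\otimes\varepsilon)\circ\delta=\mathrm{id}$. A partial action of a Hopf algebra $H$ on a unital algebra $C$ is a linear map $H\otimes C\to C$, $h\otimes c\mapsto h\triangleright c$, such that for all $h,k\in H$, $c,d\in C$ (Sweedler notation): $1_H\triangleright c=c$; $h\triangleright(cd)=(h_{(1)}\triangleright c)(h_{(2)}\triangleright d)$; $h\triangleright(k\triangleright c)=(h_{(1)}\triangleright 1_C)(h_{(2)}k\triangleright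 c)$. It is symmetric if additionally $h\triangleright(k\triangleright c)=(h_{(1)}k\triangleright c)(h_{(2)}\triangleright 1_C)$. *)

(* Defs.v *)
From HB Require Import structures.
From mathcomp Require Import all_boot all_order all_algebra.
From mathcomp Require Import all_classical all_reals all_analysis.
From mathcomp Require Import complex.

Set Implicit Arguments.
Unset Strict Implicit.
Unset Printing Implicit Defensive.

Import Order.TTheory GRing.Theory Num.Theory.
Import numFieldNormedType.Exports.

Local Open Scope classical_set_scope.
Local Open Scope ring_scope.
Local Open Scope complex_scope.

Reserved Notation "x ** y" (at level 40, left associativity).

(* Neither *-algebras nor C*-algebras are assumed unital, so their product is
   not the one of a ring structure, which would impose a unit. *)

HB.mixin Record Lmodule_isStarAlgebra (R : realType) A
    of GRing.Lmodule R[i] A := {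
  amul : A -> A -> A ;
  star : A -> A ;
  amulA : forall x y z, amul x (amul y z) = amul (amul x y) z ;
  amulDl : forall x y z, amul (x + y) z = amul x z + amul y z ;
  amulDr : forall x y z, amul x (y + z) = amul x y + amul x z ;
  amulZl : forall (k : R[i]) x y, amul (k *: x) y = k *: amul x y ;
  amulZr : forall (k : R[i]) x y, amul x (k *: y) = k *: amul x y ;
  starK : forall x, star (star x) = x ;
  starD : forall x y, star (x + y) = star x + star y ;
  starZ : forall (k : R[i]) x, star (k *: x) = (Num.conj k) *: star x ;
  starM : forall x y, star (amul x y) = amul (star y) (star x) }.

#[short(type="starAlgType")]
HB.structure Definition StarAlgebra (R : realType) :=
  { A of GRing.Lmodule R[i] A & Lmodule_isStarAlgebra R A }.

Notation "x ** y" := (amul x y) : ring_scope.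

(* The norm of a normed module over R[i] takes its values in R[i]; they are
   nonnegative, hence real. *)
HB.mixin Record StarAlgebra_isCstar (R : realType) A
    of StarAlgebra R A & CompleteNormedModule R[i] A := {
  norm_amul_le : forall x y : A, `|x ** y| <= `|x| * `|y| ;
  norm_star_amul : forall x : A, `|star x ** x| = `|x| ^+ 2 }.

#[short(type="cstarAlgType")]
HB.structure Definition CstarAlgebra (R : realType) :=
  { A of StarAlgebra R A & CompleteNormedModule R[i] A &
         StarAlgebra_isCstar R A }.

Definition is_unit (R : realType) (A : starAlgType R) (u : A) : Prop :=
  forall x, u ** x = x /\ x ** u = x.

Definition star_hom (R : realType) (A B : starAlgType R) (f : A -> B) : Prop :=
  [/\ linear f, (forall x y, f (x ** y) = f x ** f y)
    & forall x, f (star x) = star (f x)].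

Definition lin_span (K : fieldType) (V : lmodType K) (S : set V) : set V :=
  [set v | exists (n : nat) (k : 'I_n -> K) (s : 'I_n -> V),
     (forall i, S (s i)) /\ v = \sum_i k i *: s i].

Definition linearly_dense (R : realType) (A : cstarAlgType R) (S : set A) :=
  closure (lin_span S) = setT.

Definition bounded_functional (R : realType) (A : cstarAlgType R)
    (w : A -> R[i]) : Prop :=
  scalar w /\ exists r : R[i], forall x, `|w x| <= r * `|x|.

Definition character (R : realType) (A : cstarAlgType R) (w : A -> R[i]) :=
  [/\ scalar w, (forall x y, w (x ** y) = w x * w y),
      (forall x, w (star x) = Num.conj (w x)) & exists x, w x != 0].

(* M(A), as the algebra of double centralizers in the sense of Busby: for a
   C*-algebra A, linearity and boundedness of both maps and the identities
   L (x ** y) = L x ** y and R (x ** y) = x ** R y are consequences.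
   [lact m a] is m a and [ract m a] is a m. *)
Record multiplier (R : realType) (A : cstarAlgType R) := Multiplier {
  lact : A -> A ;
  ract : A -> A ;
  lractP : forall x y, x ** lact y = ract x ** y }.

Section MultiplierAlgebra.
Variables (R : realType) (A : cstarAlgType R).
Implicit Types (m n p : multiplier A) (x y z : A) (k : R[i]).

Lemma multiplierP m n : lact m =1 lact n -> ract m =1 ract n -> m = n.
Proof.
case: m n => [l r H] [l' r' H'] /= /funext E /funext E'.
by subst l' r'; congr Multiplier; exact: Prop_irrelevance.
Qed.

Lemma amul_injr y z : (forall x, x ** y = x ** z) -> y = z.
Proof.
move=> E; apply/eqP; rewrite -subr_eq0 -normr_eq0 -sqrf_eq0.
by rewrite -norm_star_amul -scaleN1r amulDr amulZr E !scaleN1r subrr normr0.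
Qed.

Lemma amul_injl y z : (forall x, y ** x = z ** x) -> y = z.
Proof.
move=> E; apply: (can_inj (@starK R A)); apply: amul_injr => x.
by rewrite -[x]starK -!starM E.
Qed.

Lemma lact_linear m : linear (lact m).
Proof.
by move=> k x y; apply: amul_injr => z; rewrite amulDr amulZr !lractP amulDr amulZr.
Qed.

Lemma ract_linear m : linear (ract m).
Proof.
by move=> k x y; apply: amul_injl => z; rewrite amulDl amulZl -!lractP amulDl amulZl.
Qed.

Fact mzero_subproof x y : x ** 0 = 0 ** y.
Proof.
by rewrite -[in LHS](scale0r y) -[in RHS](scale0r x) amulZr amulZl.
Qed.
Definition mzero := Multiplier mzero_subproof.

Fact madd_subproof m n x y :
  x ** (lact m y + lact n y) = (ract m x + ract n x) ** y.
Proof. by rewrite amulDr amulDl !lractP. Qed.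
Definition madd m n := Multiplier (madd_subproof m n).

Fact mscale_subproof k m x y : x ** (k *: lact m y) = (k *: ract m x) ** y.
Proof. by rewrite amulZr amulZl lractP. Qed.
Definition mscale k m := Multiplier (mscale_subproof k m).

Fact mopp_subproof m x y : x ** (- lact m y) = (- ract m x) ** y.
Proof.
by rewrite -(scaleN1r (lact m y)) -(scaleN1r (ract m x)) amulZr amulZl lractP.
Qed.
Definition mopp m := Multiplier (mopp_subproof m).

Fact mmul_subproof m n x y :
  x ** lact m (lact n y) = ract n (ract m x) ** y.
Proof. by rewrite !lractP. Qed.
Definition mmul m n := Multiplier (mmul_subproof m n).

Fact mstar_subproof m x y :
  x ** star (ract m (star y)) = star (lact m (star x)) ** y.
Proof. by rewrite -{1}[x]starK -starM -lractP starM starK. Qed.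
Definition mstar m := Multiplier (mstar_subproof m).

Fact mone_subproof x y : x ** y = x ** y. Proof. by []. Qed.
Definition mone : multiplier A := Multiplier mone_subproof.

Fact maddA : associative madd.
Proof. by move=> m n p; apply: multiplierP => x /=; rewrite addrA. Qed.
Fact maddC : commutative madd.
Proof. by move=> m n; apply: multiplierP => x /=; rewrite addrC. Qed.
Fact madd0 : left_id mzero madd.
Proof. by move=> m; apply: multiplierP => x /=; rewrite add0r. Qed.
Fact maddN : left_inverse mzero mopp madd.
Proof. by move=> m; apply: multiplierP => x /=; rewrite addNr. Qed.

HB.instance Definition _ := gen_eqMixin (multiplier A).
HB.instance Definition _ := gen_choiceMixin (multiplier A).
HB.instance Definition _ :=
  GRing.isZmodule.Build (multiplier A) maddA maddC madd0 maddN.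

Fact mscaleA k l m : mscale k (mscale l m) = mscale (k * l) m.
Proof. by apply: multiplierP => x /=; rewrite scalerA. Qed.
Fact mscale1 : left_id 1 mscale.
Proof. by move=> m; apply: multiplierP => x /=; rewrite scale1r. Qed.
Fact mscaleDr : right_distributive mscale +%R.
Proof. by move=> k m n; apply: multiplierP => x /=; rewrite scalerDr. Qed.
Fact mscaleDl m : {morph mscale^~ m : k l / k + l}.
Proof. by move=> k l; apply: multiplierP => x /=; rewrite scalerDl. Qed.

HB.instance Definition _ :=
  GRing.Zmodule_isLmodule.Build R[i] (multiplier A)
    mscaleA mscale1 mscaleDr mscaleDl.

Let lactD m x y : lact m (x + y) = lact m x + lact m y.
Proof. by rewrite -[x in LHS]scale1r lact_linear scale1r. Qed.
Let ractD m x y : ract m (x + y) = ract m x + ract m y.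
Proof. by rewrite -[x in LHS]scale1r ract_linear scale1r. Qed.
Let lact0 m : lact m 0 = 0.
Proof. by apply: (addrI (lact m 0)); rewrite -lactD !addr0. Qed.
Let ract0 m : ract m 0 = 0.
Proof. by apply: (addrI (ract m 0)); rewrite -ractD !addr0. Qed.
Let lactZ m k x : lact m (k *: x) = k *: lact m x.
Proof. by rewrite -[k *: x]addr0 lact_linear lact0 addr0. Qed.
Let ractZ m k x : ract m (k *: x) = k *: ract m x.
Proof. by rewrite -[k *: x]addr0 ract_linear ract0 addr0. Qed.

Fact mmulA m n p : mmul m (mmul n p) = mmul (mmul m n) p.
Proof. exact: multiplierP. Qed.
Fact mmulDl m n p : mmul (m + n) p = mmul m p + mmul n p.
Proof. by apply: multiplierP => x //=; rewrite ractD. Qed.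
Fact mmulDr m n p : mmul m (n + p) = mmul m n + mmul m p.
Proof. by apply: multiplierP => x //=; rewrite lactD. Qed.
Fact mmulZl k m n : mmul (k *: m) n = k *: mmul m n.
Proof. by apply: multiplierP => x //=; rewrite ractZ. Qed.
Fact mmulZr k m n : mmul m (k *: n) = k *: mmul m n.
Proof. by apply: multiplierP => x //=; rewrite lactZ. Qed.
Fact mstarK m : mstar (mstar m) = m.
Proof. by apply: multiplierP => x /=; rewrite !starK. Qed.
Fact mstarD m n : mstar (m + n) = mstar m + mstar n.
Proof. by apply: multiplierP => x /=; rewrite starD. Qed.
Fact mstarZ k m : mstar (k *: m) = Num.conj k *: mstar m.
Proof. by apply: multiplierP => x /=; rewrite starZ. Qed.
Fact mstarM m n : mstar (mmul m n) = mmul (mstar n) (mstar m).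
Proof. by apply: multiplierP => x /=; rewrite !starK. Qed.

HB.instance Definition _ :=
  Lmodule_isStarAlgebra.Build R (multiplier A)
    mmulA mmulDl mmulDr mmulZl mmulZr mstarK mstarD mstarZ mstarM.

Fact mult_of_subproof a x y : x ** (a ** y) = (x ** a) ** y.
Proof. exact: amulA. Qed.
Definition mult_of (a : A) : multiplier A := Multiplier (mult_of_subproof a).

(* m lies in the closed unit ball of M(A) *)
Definition mball m : Prop := forall x, `|lact m x| <= `|x|.

End MultiplierAlgebra.

Definition strict_cvg (R : realType) (X : Type) (A : cstarAlgType R)
    (F : set_system X) (f : X -> multiplier A) (m : multiplier A) : Prop :=
  forall a, (lact (f x) a @[x --> F] --> lact m a) /\
            (ract (f x) a @[x --> F] --> ract m a).

(* Strict continuity on the unit ball of a map defined on the domain X, which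
   is either A (with emb := mult_of) or M(A) (with emb := id). *)
Definition strict_on_ball (R : realType) (X : Type) (A B : cstarAlgType R)
    (emb : X -> multiplier A) (f : X -> multiplier B) : Prop :=
  forall (F : set_system X) (x : X), ProperFilter F ->
    F [set y | mball (emb y)] -> mball (emb x) ->
    strict_cvg F emb (emb x) -> strict_cvg F f (f x).

Definition strict_hom (R : realType) (A B : cstarAlgType R)
    (f : A -> multiplier B) : Prop :=
  star_hom f /\ strict_on_ball (@mult_of R A) f.

Definition strict_mhom (R : realType) (A B : cstarAlgType R)
    (f : multiplier A -> multiplier B) : Prop :=
  star_hom f /\ strict_on_ball id f.

(* The extension of a strict homomorphism to the multiplier algebra exists and
   is unique, and so do the other maps of multiplier algebras below, namely
   tensor products of multipliers, of homomorphisms and slice maps. Each of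
   them is given by its defining property, as a predicate. *)
Definition is_mult_ext (R : realType) (A B : cstarAlgType R)
    (f : A -> multiplier B) (g : multiplier A -> multiplier B) : Prop :=
  strict_mhom g /\ forall a, g (mult_of a) = f a.

(* t exhibits T as the completion of the algebraic tensor product of A and B
   in some C*-norm. The cross-norm property is automatic for C*-norms;
   [ct_inj] says that the algebraic tensor product embeds into T. *)
Record is_cstar_tensor (R : realType) (A B T : cstarAlgType R)
    (t : A -> B -> T) : Prop := {
  ct_linearl : forall b, linear (t^~ b) ;
  ct_linearr : forall a, linear (t a) ;
  ct_mul : forall a b a' b', t a b ** t a' b' = t (a ** a') (b ** b') ;
  ct_star : forall a b, star (t a b) = t (star a) (star b) ;
  ct_norm : forall a b, `|t a b| = `|a| * `|b| ;
  ct_inj : forall (n : nat) (a : 'I_n -> A) (b : 'I_n -> B),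
    (forall k : 'I_n -> R[i], \sum_i k i *: b i = 0 -> forall i, k i = 0) ->
    \sum_i t (a i) (b i) = 0 -> forall i, a i = 0 ;
  ct_dense : linearly_dense [set x | exists a b, x = t a b] }.

(* the completion in the least C*-norm *)
Definition is_min_tensor (R : realType) (A B T : cstarAlgType R)
    (t : A -> B -> T) : Prop :=
  is_cstar_tensor t /\
  forall (T' : cstarAlgType R) (t' : A -> B -> T'), is_cstar_tensor t' ->
    forall (n : nat) (a : 'I_n -> A) (b : 'I_n -> B),
      `|\sum_i t (a i) (b i)| <= `|\sum_i t' (a i) (b i)|.

Record minTensor (R : realType) (A B : cstarAlgType R) := MinTensor {
  mt_car :> cstarAlgType R ;
  tens : A -> B -> mt_car ;
  tensP : is_min_tensor tens }.

Arguments tens {R A B} _ _ _.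

(* A (x) B (x) C, seen both as (A (x) B) (x) C and as A (x) (B (x) C). *)
Record minTensor3 (R : realType) (A B C : cstarAlgType R)
    (AB : minTensor A B) (BC : minTensor B C) := MinTensor3 {
  mt3_car :> cstarAlgType R ;
  tens12_3 : AB -> C -> mt3_car ;
  tens1_23 : A -> BC -> mt3_car ;
  tens12_3P : is_min_tensor tens12_3 ;
  tens1_23P : is_min_tensor tens1_23 ;
  tens3A : forall a b c,
    tens12_3 (tens AB a b) c = tens1_23 a (tens BC b c) }.

Arguments tens12_3 {R A B C AB BC} _ _ _.
Arguments tens1_23 {R A B C AB BC} _ _ _.

(* x = m (x) n in M(A (x) B) *)
Definition is_mtens (R : realType) (A B T : cstarAlgType R) (t : A -> B -> T)
    (m : multiplier A) (n : multiplier B) (x : multiplier T) : Prop :=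
  forall a b, lact x (t a b) = t (lact m a) (lact n b) /\
              ract x (t a b) = t (ract m a) (ract n b).

(* g is the extension of f (x) id_C : A (x) C -> M(B (x) C) *)
Definition is_hom_tens_id (R : realType) (A C B : cstarAlgType R)
    (AC : minTensor A C) (T : cstarAlgType R) (t : B -> C -> T)
    (f : A -> multiplier B) (g : multiplier AC -> multiplier T) : Prop :=
  strict_mhom g /\
  forall a c, is_mtens t (f a) (mult_of c) (g (mult_of (tens AC a c))).

(* g is the extension of id_A (x) f : A (x) C -> M(A (x) B) *)
Definition is_id_tens_hom (R : realType) (A C B : cstarAlgType R)
    (AC : minTensor A C) (T : cstarAlgType R) (t : A -> B -> T)
    (f : C -> multiplier B) (g : multiplier AC -> multiplier T) : Prop :=
  strict_mhom g /\
  forall a c, is_mtens t (mult_of a) (f c) (g (mult_of (tens AC a c))).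

(* s is the extension of id_A (x) w to multipliers *)
Definition is_id_slice (R : realType) (A B : cstarAlgType R)
    (AB : minTensor A B) (w : B -> R[i])
    (s : multiplier AB -> multiplier A) : Prop :=
  [/\ linear s, strict_on_ball id s &
      forall a b, s (mult_of (tens AB a b)) = mult_of (w b *: a)].

(* s is the extension of w (x) id_B to multipliers *)
Definition is_slice_id (R : realType) (A B : cstarAlgType R)
    (AB : minTensor A B) (w : A -> R[i])
    (s : multiplier AB -> multiplier B) : Prop :=
  [/\ linear s, strict_on_ball id s &
      forall a b, s (mult_of (tens AB a b)) = mult_of (w a *: b)].

(* s is the extension of the functional v (x) w to multipliers *)
Definition is_functional_tens (R : realType) (A B : cstarAlgType R)
    (AB : minTensor A B) (v : A -> R[i]) (w : B -> R[i])
    (s : multiplier AB -> R[i]) : Prop :=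
  [/\ scalar s,
      (forall (F : set_system (multiplier AB)) (m : multiplier AB),
         ProperFilter F -> F [set x | mball x] -> mball m ->
         strict_cvg F id m -> s x @[x --> F] --> (s m : R[i]^o)) &
      forall a b, s (mult_of (tens AB a b)) = v a * w b].

Record cstarBialg (R : realType) := CstarBialg {
  bi_car :> cstarAlgType R ;
  bi_tens : minTensor bi_car bi_car ;
  bi_tens3 : minTensor3 bi_tens bi_tens ;
  comul : bi_car -> multiplier bi_tens ;
  comul_hom : star_hom comul ;
  comul_nondeg :
    linearly_dense [set x | exists a y, x = lact (comul a) y] ;
  comul_coassoc : exists f g : multiplier bi_tens -> multiplier bi_tens3,
    [/\ is_hom_tens_id (tens12_3 bi_tens3) comul f,
        is_id_tens_hom (tens1_23 bi_tens3) comul g &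
        forall a, f (comul a) = g (comul a)] }.

Arguments bi_tens {R} _.
Arguments comul {R _} _.

Definition is_counit (R : realType) (B : cstarBialg R) (e : B -> R[i]) : Prop :=
  character e /\
  exists (s s' : multiplier (bi_tens B) -> multiplier B),
    [/\ is_slice_id e s, is_id_slice e s' &
        forall a, s (comul a) = mult_of a /\ s' (comul a) = mult_of a].

Record compactQG (R : realType) := CompactQG {
  qg_car :> cstarBialg R ;
  qg_one : qg_car ;
  qg_oneP : is_unit qg_one ;
  qg_densel : linearly_dense
    [set x | exists a b, x = lact (comul a) (tens (bi_tens qg_car) qg_one b)] ;
  qg_denser : linearly_dense
    [set x | exists a b, x = ract (comul b) (tens (bi_tens qg_car) a qg_one)] }.

Arguments qg_one {R} _.

Section Corepresentations.
Variables (R : realType) (G : compactQG R).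

Definition unitary_corep (n : nat) (u : 'M[G]_n) : Prop :=
  [/\ forall i j,
        comul (u i j) = mult_of (\sum_k tens (bi_tens G) (u i k) (u k j)),
      forall i j, \sum_k star (u k i) ** u k j = if i == j then qg_one G else 0 &
      forall i j, \sum_k u i k ** star (u j k) = if i == j then qg_one G else 0].

Definition lmul_mx (m n : nat) (T : 'M[R[i]]_(m, n)) (u : 'M[G]_n) :
    'M[G]_(m, n) :=
  \matrix_(i, j) \sum_k T i k *: u k j.

Definition rmul_mx (m n : nat) (u : 'M[G]_m) (T : 'M[R[i]]_(m, n)) :
    'M[G]_(m, n) :=
  \matrix_(i, j) \sum_k T k j *: u i k.

(* The range of the idempotent P is invariant under u iff u P = P u P. *)
Definition irreducible_corep (n : nat) (u : 'M[G]_n) : Prop :=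
  (0 < n)%N /\
  forall P : 'M[R[i]]_n, P *m P = P ->
    rmul_mx u P = lmul_mx P (rmul_mx u P) -> P = 0 \/ P = 1%:M.

Definition equiv_corep (m n : nat) (v : 'M[G]_m) (u : 'M[G]_n) : Prop :=
  exists (T : 'M[R[i]]_(m, n)) (S : 'M[R[i]]_(n, m)),
    [/\ T *m S = 1%:M, S *m T = 1%:M & lmul_mx T u = rmul_mx v T].

Definition matrix_element : set G :=
  [set a | exists (n : nat) (u : 'M[G]_n),
     unitary_corep u /\ exists i j, a = u i j].

(* Irr(G), through a system of representatives *)
Record irr_system := IrrSystem {
  irr :> Type ;
  irr_dim : irr -> nat ;
  irr_rep : forall x, 'M[G]_(irr_dim x) ;
  irr_unitary : forall x, unitary_corep (irr_rep x) ;
  irr_irreducible : forall x, irreducible_corep (irr_rep x) ;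
  irr_inj : forall x y, equiv_corep (irr_rep x) (irr_rep y) -> x = y ;
  irr_complete : forall n (u : 'M[G]_n),
    unitary_corep u -> irreducible_corep u ->
    exists x, equiv_corep (irr_rep x) u }.

End Corepresentations.

Arguments irr_dim {R G i} _.
Arguments irr_rep {R G i} _.

(* An element of the algebraic tensor product H (x) H is represented by a list
   of pairs, standing for the sum of the corresponding elementary tensors. Two
   lists represent the same element iff they are not separated by bilinear
   forms, and similarly for H (x) H (x) H. *)
Section AlgebraicTensors.
Variables (K : fieldType) (H : lmodType K).

Definition bilinear_form (b : H -> H -> K) : Prop :=
  (forall x, scalar (b x)) /\ (forall y, scalar (b^~ y)).

Definition trilinear_form (b : H -> H -> H -> K) : Prop :=
  [/\ forall x y, scalar (b x y), forall x z, scalar (fun y => b x y z) &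
      forall y z, scalar (fun x => b x y z)].

Definition tens2_eq (s t : seq (H * H)) : Prop :=
  forall b, bilinear_form b ->
    \sum_(p <- s) b p.1 p.2 = \sum_(p <- t) b p.1 p.2.

Definition tens3_eq (s t : seq (H * H * H)) : Prop :=
  forall b, trilinear_form b ->
    \sum_(p <- s) b p.1.1 p.1.2 p.2 = \sum_(p <- t) b p.1.1 p.1.2 p.2.

End AlgebraicTensors.

(* \sum_(p <- hcomul h) p.1 (x) p.2 is h_(1) (x) h_(2). *)
Record hopfAlg (K : fieldType) := HopfAlg {
  hopf_car :> algType K ;
  hcomul : hopf_car -> seq (hopf_car * hopf_car) ;
  hcounit : hopf_car -> K ;
  hantipode : hopf_car -> hopf_car ;
  hcomul_linear : forall k g h,
    tens2_eq (hcomul (k *: g + h))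
             ([seq (k *: p.1, p.2) | p <- hcomul g] ++ hcomul h) ;
  hcomul1 : tens2_eq (hcomul 1) [:: (1, 1)] ;
  hcomulM : forall g h,
    tens2_eq (hcomul (g * h))
             [seq (p.1 * q.1, p.2 * q.2) | p <- hcomul g, q <- hcomul h] ;
  hcomulA : forall h,
    tens3_eq [seq (q.1, q.2, p.2) | p <- hcomul h, q <- hcomul p.1]
             [seq (p.1, q.1, q.2) | p <- hcomul h, q <- hcomul p.2] ;
  hcounit_scalar : scalar hcounit ;
  hcounit1 : hcounit 1 = 1 ;
  hcounitM : forall g h, hcounit (g * h) = hcounit g * hcounit h ;
  hcounitl : forall h, \sum_(p <- hcomul h) hcounit p.1 *: p.2 = h ;
  hcounitr : forall h, \sum_(p <- hcomul h) hcounit p.2 *: p.1 = h ;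
  hantipode_linear : linear hantipode ;
  hantipodel : forall h,
    \sum_(p <- hcomul h) hantipode p.1 * p.2 = (hcounit h)%:A ;
  hantipoder : forall h,
    \sum_(p <- hcomul h) p.1 * hantipode p.2 = (hcounit h)%:A }.

Arguments hcomul {K _} _.

(* e identifies the Hopf algebra H with O(G). Elements of O(G) are linear
   combinations of matrix coefficients of finite-dimensional unitary
   corepresentations, and the structure maps of O(G) are inherited from G;
   counit and antipode are then unique. *)
Record is_matrix_Hopf_algebra (R : realType) (G : compactQG R)
    (H : hopfAlg R[i]) (e : H -> G) : Prop := {
  mha_linear : linear e ;
  mha_one : e 1 = qg_one G ;
  mha_mul : forall g h, e (g * h) = e g ** e h ;
  mha_inj : injective e ;
  mha_range : range e = lin_span (@matrix_element R G) ;
  mha_comul : forall h,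
    comul (e h) =
    mult_of (\sum_(p <- hcomul h) tens (bi_tens G) (e p.1) (e p.2)) }.

(* the operator norm of M on the Hilbert space C^n is at most r *)
Definition opnorm_le (R : realType) (n : nat) (M : 'M[R[i]]_n) (r : R[i]) :=
  forall v : 'cV[R[i]]_n,
    \sum_i `|(M *m v) i ord0| ^+ 2 <= r ^+ 2 * \sum_i `|v i ord0| ^+ 2.

(* The coordinates c identify B with the c_0-direct sum of the full matrix
   algebras of size d x, for x in I. *)
Record c0_matrix_sum (R : realType) (I : Type) (d : I -> nat)
    (B : cstarAlgType R) (c : forall x, B -> 'M[R[i]]_(d x)) : Prop := {
  c0_linear : forall x, linear (c x) ;
  c0_mul : forall x a b, c x (a ** b) = c x a *m c x b ;
  c0_star : forall x a, c x (star a) = (map_mx Num.conj (c x a))^T ;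
  c0_norm : forall a (r : R[i]), 0 <= r ->
    (`|a| <= r <-> forall x, opnorm_le (c x a) r) ;
  c0_vanish : forall a (r : R[i]), 0 < r ->
    finite_set [set x | ~ opnorm_le (c x a) r] ;
  c0_full : forall f : (forall x, 'M[R[i]]_(d x)),
    (forall r : R[i], 0 < r -> finite_set [set x | ~ opnorm_le (f x) r]) ->
    exists a, forall x, c x a = f x }.

(* w vanishes on all but finitely many of the summands *)
Definition finitely_supported (R : realType) (I : Type) (d : I -> nat)
    (B : cstarAlgType R) (c : forall x, B -> 'M[R[i]]_(d x))
    (w : B -> R[i]) : Prop :=
  finite_set [set x | exists a, (forall y, y <> x -> c y a = 0) /\ w a <> 0].

(* B is the discrete dual of G: [dd_pair] identifies O(G) with the finitely
   supported functionals on B, the coefficient (i, j) of [irr_rep x] being the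
   matrix entry (i, j) in the summand x; [dd_pairM] then determines the
   comultiplication of B. *)
Record discrete_dual (R : realType) (G : compactQG R) (H : hopfAlg R[i])
    (e : H -> G) (B : cstarBialg R) := DiscreteDual {
  dd_irr : irr_system G ;
  dd_coord : forall x : dd_irr, B -> 'M[R[i]]_(irr_dim x) ;
  dd_coordP : c0_matrix_sum dd_coord ;
  dd_pair : H -> B -> R[i] ;
  dd_pair_linear : forall (k : R[i]) g h b,
    dd_pair (k *: g + h) b = k * dd_pair g b + dd_pair h b ;
  dd_pair_functional : forall h,
    bounded_functional (dd_pair h) /\ finitely_supported dd_coord (dd_pair h) ;
  dd_pair_inj : injective dd_pair ;
  dd_pair_surj : forall w : B -> R[i],
    bounded_functional w -> finitely_supported dd_coord w ->
    exists h, dd_pair h = w ;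
  dd_pair_coord : forall h (x : dd_irr) i j,
    e h = irr_rep x i j -> forall b, dd_pair h b = dd_coord x b i j ;
  dd_pair_comul : forall h a b,
    \sum_(p <- hcomul h) dd_pair p.1 a * dd_pair p.2 b = dd_pair h (a ** b) ;
  dd_pairM : forall g h, exists s : multiplier (bi_tens B) -> R[i],
    is_functional_tens (dd_pair g) (dd_pair h) s /\
    forall b, dd_pair (g * h) b = s (comul b) ;
  dd_pair1 : is_counit (dd_pair 1) }.

Section PartialCoaction.
Variables (R : realType) (B : cstarBialg R) (C : cstarAlgType R).
Variables (CB : minTensor C B) (CBB : minTensor3 CB (bi_tens B)).

Definition partial_coaction (d : C -> multiplier CB) : Prop :=
  [/\ strict_hom d,
      (forall c b, exists (y : multiplier CB) (x : CB),
         is_mtens (tens CB) (mone C) (mult_of b) y /\ d c ** y = mult_of x) &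
      exists (d' : multiplier C -> multiplier CB)
             (f g : multiplier CB -> multiplier CBB) (p : multiplier CBB),
        [/\ is_mult_ext d d',
            is_hom_tens_id (tens12_3 CBB) d f,
            is_id_tens_hom (tens1_23 CBB) comul g,
            is_mtens (tens12_3 CBB) (d' (mone C)) (mone B) p &
            forall c, f (d c) = p ** g (d c)]].

Definition counital (d : C -> multiplier CB) : Prop :=
  exists e : B -> R[i], is_counit e /\
  exists s : multiplier CB -> multiplier C,
    is_id_slice e s /\ forall c, s (d c) = mult_of c.

End PartialCoaction.

(* The unital algebra is given by its module C, product and unit. *)
Section PartialAction.
Variables (K : fieldType) (H : hopfAlg K) (C : lmodType K).
Variables (mul : C -> C -> C) (one : C) (act : H -> C -> C).

Definition partial_action : Prop :=
  [/\ (forall c, linear (act^~ c)) /\ (forall h, linear (act h)),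
      forall c, act 1 c = c,
      forall h c d,
        act h (mul c d) = \sum_(p <- hcomul h) mul (act p.1 c) (act p.2 d) &
      forall h k c,
        act h (act k c) =
        \sum_(p <- hcomul h) mul (act p.1 one) (act (p.2 * k) c)].

Definition symmetric_partial_action : Prop :=
  partial_action /\
  forall h k c,
    act h (act k c) =
    \sum_(p <- hcomul h) mul (act (p.1 * k) c) (act p.2 one).

End PartialAction.

(* Main.v *)
(* Every functional w on the dual that comes from O(G) lives on finitely many
   matrix blocks, so w = w(q . ) = w( . q) for a central projection q of finite
   rank, and the slice id (x) w is bounded on C (x) A^.  On multipliers it is
   m |-> (id (x) w)(m (1 (x) q)), which is strictly continuous, and strictly
   continuous linear maps are determined on bounded multipliers by their values
   on elementary tensors.  This gives, with S_w = id (x) w,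
     S_k (f(m) (z (x) q)) = delta (S_k m) z          for f = delta (x) id,
     S_h (S_k (g(m) (1 (x) q (x) q))) = S_{hk} m     for g = id (x) Delta^,
     S_h (x y) = S_{h_(1)} (x) S_{h_(2)} (y),
   the last one by density.  Applied to f(delta c) = p g(delta c), with
   p = delta(1) (x) 1, they yield h |> (k |> c) = (h_(1) |> 1) (h_(2) k |> c);
   taking adjoints, f(delta c) = g(delta c) p as well, which gives the symmetric
   identity.  Finally, any counit of the dual is finitely supported, hence is
   the pairing with some h in O(G), and h = h 1 = 1. *)
From HB Require Import structures.
Require Import Defs.
From mathcomp Require Import all_boot all_order all_algebra.
From mathcomp Require Import all_classical all_reals all_analysis.
From mathcomp Require Import complex.
From mathcomp Require Import finmap summability ring.

Set Implicit Arguments.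
Unset Strict Implicit.
Unset Printing Implicit Defensive.

Import Order.TTheory GRing.Theory Num.Theory.
Import numFieldNormedType.Exports.

Local Open Scope classical_set_scope.
Local Open Scope ring_scope.
Local Open Scope complex_scope.

#[local] Existing Instance totally_filter.

(** * Bounded linear maps and norms *)

Section Linear.
Variables (K : pzRingType) (V W : lmodType K) (f : V -> W).
Hypothesis lf : linear f.

Lemma linD x y : f (x + y) = f x + f y.
Proof. by rewrite -[x in LHS]scale1r lf scale1r. Qed.

Lemma lin0 : f 0 = 0.
Proof. by apply: (addrI (f 0)); rewrite -linD !addr0. Qed.

Lemma linZ k x : f (k *: x) = k *: f x.
Proof. by rewrite -[k *: x in LHS]addr0 lf lin0 addr0. Qed.

Lemma linB x y : f (x - y) = f x - f y.
Proof. by rewrite linD -scaleN1r linZ scaleN1r. Qed.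

Lemma lin_sum (I : Type) (r : seq I) (P : pred I) (F : I -> V) :
  f (\sum_(i <- r | P i) F i) = \sum_(i <- r | P i) f (F i).
Proof. exact: (big_morph f linD lin0). Qed.

End Linear.

Section BoundedLinear.
Variable K : numFieldType.

Definition bounded_linear (V W : normedModType K) (f : V -> W) :=
  linear f /\ exists2 M : K, 0 <= M & forall x, `|f x| <= M * `|x|.

Lemma bounded_linear_cvg (V W : normedModType K) (f : V -> W)
    (X : Type) (F : set_system X) (FF : Filter F) (u : X -> V) (x : V) :
  bounded_linear f -> u y @[y --> F] --> x -> f (u y) @[y --> F] --> f x.
Proof.
move=> [lf [M M0 fM]] ux; apply/cvgrPdist_le => e e0.
have e'0 : 0 < e / (M + 1) by rewrite divr_gt0 // ltr_wpDl.
move/cvgrPdist_le: ux => /(_ _ e'0); apply: filterS => y uy.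
rewrite -linB // (le_trans (fM _)) // (le_trans (ler_wpM2l M0 uy)) //.
rewrite mulrCA ger_pMr // ler_pdivrMr ?mul1r ?ltr_wpDl //.
by rewrite lerDl.
Qed.

Lemma bounded_linear_comp (U V W : normedModType K) (f : V -> W) (g : U -> V) :
  bounded_linear f -> bounded_linear g -> bounded_linear (fun x => f (g x)).
Proof.
move=> [lf [M M0 fM]] [lg [N N0 gN]]; split; first by move=> k x y; rewrite lg lf.
exists (M * N); first exact: mulr_ge0.
by move=> x; rewrite (le_trans (fM _)) // -mulrA ler_wpM2l.
Qed.

Lemma bounded_linearZD (V W : normedModType K) (k : K) (f g : V -> W) :
  bounded_linear f -> bounded_linear g ->
  bounded_linear (fun x => k *: f x + g x).
Proof.
move=> [lf [M M0 fM]] [lg [N N0 gN]]; split.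
  move=> l x y; rewrite lf lg !scalerDr !scalerA [k * l]mulrC -!addrA.
  by congr (_ + _); rewrite addrCA.
exists (`|k| * M + N); first by rewrite addr_ge0 // mulr_ge0.
move=> x; rewrite (le_trans (ler_normD _ _)) // mulrDl lerD //.
by rewrite normrZ -mulrA ler_wpM2l.
Qed.

Lemma bounded_linear_zero (V W : normedModType K) :
  bounded_linear (fun _ : V => 0 : W).
Proof.
split; first by move=> k x y; rewrite scaler0 addr0.
by exists 0 => // x; rewrite normr0 mul0r.
Qed.

Lemma bounded_linear_sum (V W : normedModType K) (I : Type) (r : seq I)
    (k : I -> K) (f : I -> V -> W) :
  (forall i, bounded_linear (f i)) ->
  bounded_linear (fun x => \sum_(i <- r) k i *: f i x).
Proof.
move=> fb; elim: r => [|i r IH].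
  rewrite (_ : (fun x => _) = fun=> 0); first exact: bounded_linear_zero.
  by apply/funext => x; rewrite big_nil.
rewrite (_ : (fun x => _) =
    fun x => k i *: f i x + \sum_(j <- r) k j *: f j x).
  exact: bounded_linearZD.
by apply/funext => x; rewrite big_cons.
Qed.

Lemma linear_continuous0_bounded (V W : normedModType K) (f : V -> W) :
  linear f -> f x @[x --> 0] --> (0 : W) -> bounded_linear f.
Proof.
move=> lf f0; split=> //.
pose g : {linear V -> W} := HB.pack f (GRing.isLinear.Build _ _ _ _ _ lf).
have : {for 0, continuous g} by rewrite /prop_for /continuous_at /= lin0.
move=> /continuous_linear_bounded /linear_boundedP /pinfty_ex_gt0 [r r0 fr].
by exists r => //; exact: ltW.
Qed.

Lemma cvg_norm_le (V W : normedModType K) (X : Type) (F : set_system X)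
    (FF : Filter F) (f : X -> V) (g : X -> W) (M : K) :
  0 <= M -> (forall x, `|f x| <= M * `|g x|) ->
  g x @[x --> F] --> (0 : W) -> f x @[x --> F] --> (0 : V).
Proof.
move=> M0 fg g0; apply/cvgr0Pnorm_le => e e0.
have e'0 : 0 < e / (M + 1) by rewrite divr_gt0 // ltr_wpDl.
move/cvgr0Pnorm_le: g0 => /(_ _ e'0); apply: filterS => x gx.
rewrite (le_trans (fg x)) // (le_trans (ler_wpM2l M0 gx)) //.
rewrite mulrCA ger_pMr // ler_pdivrMr ?mul1r ?ltr_wpDl //.
by rewrite lerDl.
Qed.

Lemma norm_small_eq0 (V : normedModType K) (x : V) (M : K) : 0 <= M ->
  (forall e : K, 0 < e -> `|x| <= M * e) -> x = 0.
Proof.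
move=> M0 xM; apply/eqP; rewrite -normr_le0.
apply/ler_addgt0Pr => e e0; rewrite add0r.
have e'0 : 0 < e / (M + 1) by rewrite divr_gt0 // ltr_wpDl.
rewrite (le_trans (xM _ e'0)) // mulrCA ger_pMr // ler_pdivrMr ?ltr_wpDl //.
by rewrite mul1r lerDl.
Qed.

End BoundedLinear.

(** * Norm identities in a C*-algebra *)

Section CstarNorm.
Variables (R : realType) (A : cstarAlgType R).
Implicit Types x y z : A.

Lemma amul0x x : 0 ** x = 0.
Proof. by rewrite -[0 in LHS](scale0r 0) amulZl scale0r. Qed.

Lemma amulx0 x : x ** 0 = 0.
Proof. by rewrite -[0 in LHS](scale0r 0) amulZr scale0r. Qed.

Lemma amul_sumr (I : Type) (r : seq I) (F : I -> A) z :
  z ** (\sum_(i <- r) F i) = \sum_(i <- r) z ** F i.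
Proof. exact: (big_morph _ (amulDr z) (amulx0 z)). Qed.

Lemma amul_suml (I : Type) (r : seq I) (F : I -> A) z :
  (\sum_(i <- r) F i) ** z = \sum_(i <- r) F i ** z.
Proof. by apply: (big_morph (amul^~ z)) => [x y|]; rewrite ?amulDl ?amul0x. Qed.

Lemma bounded_linear_amull z : bounded_linear (amul z : A -> A).
Proof.
split; first by move=> k x y; rewrite amulDr amulZr.
by exists `|z| => // x; exact: norm_amul_le.
Qed.

Lemma bounded_linear_amulr z : bounded_linear (amul^~ z : A -> A).
Proof.
split; first by move=> k x y; rewrite amulDl amulZl.
by exists `|z| => // x; rewrite mulrC; exact: norm_amul_le.
Qed.

(** The C*-identity gives [|y|^2 <= |star y| |y|]; applying the resulting inequality to [star x] as
    well gives equality. *)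
Lemma norm_star x : `|star x| = `|x|.
Proof.
have le y : `|y| <= `|star y|.
  have [->|y0] := eqVneq y 0; first by rewrite normr0.
  rewrite -(@ler_pM2r _ `|y|) ?normr_gt0 // -expr2 -norm_star_amul.
  exact: norm_amul_le.
by apply/eqP; rewrite eq_le le andbT -{2}[x]starK le.
Qed.

(* Testing against [star x] on both sides replaces an approximate unit. *)
Lemma norm_le_sandwich x (M : R[i]) : 0 <= M ->
  (forall y z, `|y ** x ** z| <= M * (`|y| * `|z|)) -> `|x| <= M.
Proof.
move=> M0 xM; have [->|x0] := eqVneq x 0; first by rewrite normr0.
have x0' : 0 < `|x| by rewrite normr_gt0.
have h := xM (star x) (star x).
rewrite norm_star in h.
rewrite -(@ler_pM2r _ (`|x| * `|x|)) ?mulr_gt0 //.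
apply: le_trans h.
rewrite -(@ler_pM2r _ `|x|) //.
apply: le_trans (norm_amul_le _ _).
have -> : star x ** x ** star x ** x = star (star x ** x) ** (star x ** x).
  by rewrite starM starK !amulA.
by rewrite norm_star_amul norm_star_amul !expr2 !mulrA.
Qed.

End CstarNorm.

(** * Density of elementary tensors *)

Section TensorDensity.
Variables (R : realType) (A B T : cstarAlgType R) (t : A -> B -> T).
Hypothesis tP : is_cstar_tensor t.

(** Scalars are absorbed into the left leg, so that a plain list of pairs represents any linear
    combination. *)
Lemma tensor_approx (x : T) (e : R[i]) : 0 < e ->
  exists s : seq (A * B), `|x - \sum_(p <- s) t p.1 p.2| < e.
Proof.
move=> e0; have : closure (lin_span [set x | exists a b, x = t a b]) x.
  by rewrite (ct_dense tP).
move=> /(_ _ (nbhsx_ballx x e e0)) [y [[n [k [v [vt ->]]]]]].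
rewrite -ball_normE /= => xy.
have /choice[ab abE] : forall i, exists p : A * B, v i = t p.1 p.2.
  by move=> i; have [a [b ->]] := vt i; exists (a, b).
exists [seq (k i *: (ab i).1, (ab i).2) | i <- enum 'I_n].
rewrite big_map big_enum /=; apply: le_lt_trans xy.
rewrite le_eqVlt; apply/orP; left; apply/eqP; congr (`|_ - _|).
by apply: eq_bigr => i _; rewrite abE -(linZ (ct_linearl tP _)).
Qed.

(** The difference is bounded and kills finite sums of elementary tensors, so its value at [x] is
    controlled by the error of approximating [x]. *)
Lemma bounded_linear_eq (V : normedModType R[i]) (f g : T -> V) :
  bounded_linear f -> bounded_linear g -> (forall a b, f (t a b) = g (t a b)) ->
  f =1 g.
Proof.
move=> fb gb fg x; suff : -1 *: f x + g x = 0.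
  by rewrite scaleN1r addrC => /eqP; rewrite subr_eq0 => /eqP.
have [lh [M M0 hM]] := bounded_linearZD (-1) fb gb.
apply: (norm_small_eq0 M0) => e e0; have [s xs] := tensor_approx x e0.
have h0 : -1 *: f (\sum_(p <- s) t p.1 p.2) + g (\sum_(p <- s) t p.1 p.2) = 0.
  rewrite (lin_sum fb.1) (lin_sum gb.1).
  rewrite scaleN1r addrC -sumrB big1 // => p _.
  by rewrite fg subrr.
have := linB lh x (\sum_(p <- s) t p.1 p.2); rewrite h0 subr0 => <-.
by rewrite (le_trans (hM _)) // ler_wpM2l // ltW.
Qed.

Lemma bounded_linear_tensl b : bounded_linear (t^~ b).
Proof.
split; first exact: ct_linearl.
by exists `|b| => // a; rewrite (ct_norm tP) mulrC.
Qed.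

Lemma bounded_linear_tensr a : bounded_linear (t a).
Proof.
split; first exact: ct_linearr.
by exists `|a| => // b; rewrite (ct_norm tP).
Qed.

(** A net is encoded as a filter on an arbitrary index type, which covers both finite sets of matrix
    blocks and a constant unit. *)
Definition approx_unit (D : cstarAlgType R) (X : Type) (F : set_system X)
    (u : X -> D) :=
  (forall i, `|u i| <= 1) /\
  forall a, (u i ** a @[i --> F] --> a) /\ (a ** u i @[i --> F] --> a).

(** An [e / 3] argument: contractivity is uniform in [i], so convergence on finite sums of
    elementary tensors passes to their limits. *)
Lemma contractions_cvg_id (X : Type) (F : set_system X) (FF : Filter F)
    (f : X -> T -> T) :
  (forall i, linear (f i)) -> (forall i x, `|f i x| <= `|x|) ->
  (forall a b, f i (t a b) @[i --> F] --> t a b) ->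
  forall x, f i x @[i --> F] --> x.
Proof.
move=> lf f1 ft x; apply/cvgrPdist_le => e e0.
have e3 : 0 < e / 3 by rewrite divr_gt0.
have [s xs] := tensor_approx x e3.
set y := \sum_(p <- s) _ in xs.
have : f i y @[i --> F] --> y.
  rewrite (_ : (fun i => _) = fun i => \sum_(p <- s) f i (t p.1 p.2)); last first.
    by apply/funext => i; rewrite lin_sum.
  rewrite /y; elim: (s) => [|p r IH].
    under eq_fun do rewrite big_nil.
    by rewrite big_nil; exact: cvg_cst.
  under eq_fun do rewrite big_cons.
  by rewrite big_cons; apply: cvgD.
move/cvgrPdist_le => /(_ _ e3); apply: filterS => i yi.
rewrite (_ : x - f i x = (x - y) + (y - f i y) + f i (y - x)); last first.
  by rewrite (linB (lf i)) !subrKA.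
have -> : e = e / 3 + e / 3 + e / 3.
  by rewrite -!mulrDl -mulr2n -mulrSr -[e *+ 3]mulr_natr mulfK // pnatr_eq0.
rewrite (le_trans (ler_normD _ _)) // lerD //.
  by rewrite (le_trans (ler_normD _ _)) // lerD // ltW.
by rewrite (le_trans (f1 _ _)) // distrC ltW.
Qed.

Lemma approx_unit_tens (X : Type) (F : set_system X) (FF : Filter F)
    (u : X -> A) (v : X -> B) :
  approx_unit F u -> approx_unit F v -> approx_unit F (fun i => t (u i) (v i)).
Proof.
move=> [u1 uP] [v1 vP].
have t1 i : `|t (u i) (v i)| <= 1.
  by rewrite (ct_norm tP) mulr_ile1.
(* Joint convergence of tensors: the error in the left leg is multiplied by a right leg that stays
   bounded. *)
have tcvg (f : X -> A) (g : X -> B) (a : A) (b : B) : (forall i, `|g i| <= `|b|) ->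
    f i @[i --> F] --> a -> g i @[i --> F] --> b ->
    t (f i) (g i) @[i --> F] --> t a b.
  move=> gb fa gb'.
  rewrite (_ : (fun i => _) = fun i => t (f i - a) (g i) + t a (g i)); last first.
    by apply/funext => i; rewrite (linB (ct_linearl tP _)) subrK.
  rewrite -[X in _ --> X]add0r; apply: cvgD; last first.
    exact: (bounded_linear_cvg FF (bounded_linear_tensr a)).
  have le i : `|t (f i - a) (g i)| <= `|b| * `|f i - a|.
    by rewrite (ct_norm tP) mulrC ler_wpM2r.
  apply: (cvg_norm_le FF (normr_ge0 b) le).
  by rewrite -(subrr a); apply: cvgB => //; exact: cvg_cst.
split=> // x; split.
  apply: (contractions_cvg_id FF (f := fun i x => t (u i) (v i) ** x) _ _ _)
    => [i|i y|a b].
  - exact: (bounded_linear_amull _).1.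
  - by rewrite (le_trans (norm_amul_le _ _)) // ler_piMl.
  - under eq_fun do rewrite (ct_mul tP).
    apply: tcvg (uP a).1 (vP b).1 => i.
    by rewrite (le_trans (norm_amul_le _ _)) // ler_piMl.
apply: (contractions_cvg_id FF (f := fun i x => x ** t (u i) (v i)) _ _ _)
  => [i|i y|a b].
- exact: (bounded_linear_amulr _).1.
- by rewrite (le_trans (norm_amul_le _ _)) // ler_piMr.
- under eq_fun do rewrite (ct_mul tP).
  apply: tcvg (uP a).2 (vP b).2 => i.
  by rewrite (le_trans (norm_amul_le _ _)) // ler_piMr.
Qed.

(* The closure of the graph of [t a b |-> w b *: a] is again the graph of a
   function, and it is total because [A] is complete. *)
Lemma bounded_slice (w : B -> R[i]) (M : R[i]) : scalar w -> 0 <= M ->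
  (forall s : seq (A * B), `|\sum_(p <- s) w p.2 *: p.1| <=
                           M * `|\sum_(p <- s) t p.1 p.2|) ->
  exists S : T -> A, bounded_linear S /\ forall a b, S (t a b) = w b *: a.
Proof.
move=> lw M0 wM.
pose rel (x : T) (z : A) := forall e : R[i], 0 < e -> exists s : seq (A * B),
  `|x - \sum_(p <- s) t p.1 p.2| <= e /\ `|z - \sum_(p <- s) w p.2 *: p.1| <= e.
have relZD k x z x' z' : rel x z -> rel x' z' -> rel (k *: x + x') (k *: z + z').
  move=> xz xz' e e0.
  have e'0 : 0 < e / (`|k| + 1) by rewrite divr_gt0 // ltr_wpDl.
  have [s [s1 s2]] := xz _ e'0; have [s' [s'1 s'2]] := xz' _ e'0.
  exists ([seq (k *: p.1, p.2) | p <- s] ++ s').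
  have -> : \sum_(p <- [seq (k *: p.1, p.2) | p <- s] ++ s') t p.1 p.2 =
      k *: \sum_(p <- s) t p.1 p.2 + \sum_(p <- s') t p.1 p.2.
    rewrite big_cat big_map /= scaler_sumr; congr (_ + _).
    by apply: eq_bigr => p _; rewrite (linZ (ct_linearl tP _)).
  have -> : \sum_(p <- [seq (k *: p.1, p.2) | p <- s] ++ s') w p.2 *: p.1 =
      k *: \sum_(p <- s) w p.2 *: p.1 + \sum_(p <- s') w p.2 *: p.1.
    rewrite big_cat big_map /= scaler_sumr; congr (_ + _).
    by apply: eq_bigr => p _; rewrite !scalerA mulrC.
  have bnd (V : normedModType R[i]) (u v u' v' : V) :
      `|u - v| <= e / (`|k| + 1) -> `|u' - v'| <= e / (`|k| + 1) ->
      `|k *: u + u' - (k *: v + v')| <= e.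
    move=> uv uv'; rewrite opprD addrACA -scalerBr.
    have -> : e = `|k| * (e / (`|k| + 1)) + e / (`|k| + 1).
      by rewrite -[X in _ + X]mul1r -mulrDl mulrC divfK.
    by rewrite (le_trans (ler_normD _ _)) // lerD // normrZ ler_wpM2l.
  by split; exact: bnd.
have rel_bnd x z : rel x z -> `|z| <= M * `|x|.
  move=> xz; apply/ler_addgt0Pr => e e0.
  have e'0 : 0 < e / (M + 1) by rewrite divr_gt0 // ltr_wpDl.
  have [s [s1 s2]] := xz _ e'0.
  rewrite -[z](subrK (\sum_(p <- s) w p.2 *: p.1)).
  rewrite (le_trans (ler_normD _ _)) //.
  rewrite (le_trans (lerD s2 (wM s))) //.
  have : `|\sum_(p <- s) t p.1 p.2| <= e / (M + 1) + `|x|.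
    rewrite -[\sum_(p <- s) _](subrK x) (le_trans (ler_normD _ _)) //.
    by rewrite lerD // distrC.
  move=> /(ler_wpM2l M0) h; rewrite (le_trans (lerD (lexx _) h)) //.
  rewrite mulrDr addrA addrC lerD // -[X in X + _]mul1r -mulrDl addrC.
  by rewrite mulrC divfK // lt0r_neq0 // ltr_wpDl.
have rel_tens a b : rel (t a b) (w b *: a).
  by move=> e e0; exists [:: (a, b)]; rewrite !big_seq1 !subrr !normr0 ltW.
have rel_tot x : exists z, rel x z.
  (* A base of [F] is given by the values on finite sums within [e] of [x]; the estimate [wM] makes
     it Cauchy. *)
  pose F := filter_from [set e : R[i] | 0 < e] (fun e => [set z | exists2 s,
    `|x - \sum_(p <- s) t p.1 p.2| <= e & z = \sum_(p <- s) w p.2 *: p.1]).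
  have FF : ProperFilter F.
    apply: filter_from_proper; last first.
      move=> e /= e0; have [s xs] := tensor_approx x e0.
      by exists (\sum_(p <- s) w p.2 *: p.1); exists s => //; exact: ltW.
    apply: filter_from_filter; first by exists 1; exact: ltr01.
    (* An explicit positive number below both [e] and [e']. *)
    move=> e e' /= e0 e'0; exists (e * e' / (e + e')).
      by rewrite divr_gt0 ?mulr_gt0 ?addr_gt0.
    have h : forall d d' : R[i], 0 < d -> 0 < d' -> d * d' / (d + d') <= d.
      move=> d d' d0 d'0; rewrite ler_pdivrMr ?addr_gt0 //.
      by rewrite ler_pM2l // lerDr ltW.
    move=> z [s s1 ->]; split; exists s => //.
      exact: le_trans s1 (h _ _ _ _).
    by apply: le_trans s1 _; rewrite (mulrC e) (addrC e); exact: h.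
  have : cvg F.
    apply: cauchy_cvg; apply: cauchy_exP => e e0.
    (* Two sums this close to [x] are within twice this distance of each other, so their values
       differ by less than [e]. *)
    have e'0 : 0 < e / (M * 2 + 1) by rewrite divr_gt0 // ltr_wpDl // mulr_ge0.
    have [s xs] := tensor_approx x e'0.
    exists (\sum_(p <- s) w p.2 *: p.1), (e / (M * 2 + 1)) => //= z [s' s'1 ->].
    rewrite -ball_normE /=.
    (* A difference of two list sums is again a list sum, with the left legs of the second list
       negated, so [wM] applies to it. *)
    have E (V : lmodType R[i]) (f : A -> B -> V) : (forall b, linear (f^~ b)) ->
        \sum_(p <- s) f p.1 p.2 - \sum_(p <- s') f p.1 p.2 =
        \sum_(p <- s ++ [seq (- p.1, p.2) | p <- s']) f p.1 p.2.
      move=> lf; rewrite big_cat big_map /= -sumrN; congr (_ + _).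
      apply: eq_bigr => p _.
      by rewrite -[in RHS]scaleN1r (linZ (lf _)) scaleN1r.
    rewrite (E _ (fun a b => w b *: a)); last first.
      by move=> b k u v; rewrite scalerDr !scalerA mulrC.
    rewrite (le_lt_trans (wM _)) // -E; last exact: ct_linearl.
    have : `|\sum_(p <- s) t p.1 p.2 - \sum_(p <- s') t p.1 p.2| <=
        e / (M * 2 + 1) * 2.
      rewrite -(subrKA x) (le_trans (ler_normD _ _)) // mulrDr mulr1 lerD //.
      by rewrite distrC ltW.
    move=> /(ler_wpM2l M0) h; rewrite (le_lt_trans h) //.
    rewrite [_ * 2]mulrC mulrA mulrCA gtr_pMr // ltr_pdivrMr ?mul1r ?ltrDl //.
    by rewrite ltr_wpDl // mulr_ge0.
  move=> /cvg_ex[z Fz]; exists z => e e0.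
  have Fe : F [set z' | exists2 s, `|x - \sum_(p <- s) t p.1 p.2| <= e
      & z' = \sum_(p <- s) w p.2 *: p.1] by exists e.
  have /(filterI Fe) := Fz _ (nbhsx_ballx z e e0).
  move=> /filter_ex[z' [[s s1 ->]]]; rewrite -ball_normE /= => s2.
  by exists s; split=> //; exact: ltW.
have /choice[S SP] := rel_tot.
(* By linearity [z' - z] is related to [0], and [rel_bnd] then forces it to vanish. *)
have uniq x z z' : rel x z -> rel x z' -> z = z'.
  move=> xz xz'; have := rel_bnd _ _ (relZD (-1) _ _ _ _ xz xz').
  rewrite !scaleN1r addNr normr0 mulr0 normr_le0 addrC subr_eq0 => /eqP.
  by [].
exists S; split; last by move=> a b; exact: uniq (SP _) (rel_tens a b).
split; last by exists M => // x; exact: rel_bnd.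
by move=> k x y; apply: uniq (SP _) (relZD _ _ _ _ _ (SP x) (SP y)).
Qed.

End TensorDensity.

(** * Strict continuity *)

Section MultiplierBounds.
Variables (R : realType) (T : cstarAlgType R).
Implicit Types (m n : multiplier T) (x y : T).

Lemma lact_amul m x y : lact m (x ** y) = lact m x ** y.
Proof. by apply: amul_injr => z; rewrite lractP !amulA lractP. Qed.

Lemma lact_star m x : star (lact m x) = ract (mstar m) (star x).
Proof. by rewrite /= starK. Qed.

Lemma linear_mult_of : linear (@mult_of R T).
Proof.
move=> k x y; apply: multiplierP => z /=.
  by rewrite amulDl amulZl.
by rewrite amulDr amulZr.
Qed.

(** Positivity of [M] allows rescaling the multiplier into the unit ball. *)
Definition bounded_mult m := exists2 M : R[i], 0 < M &
  forall x, `|lact m x| <= M * `|x|.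

(** The counterpart of [strict_on_ball id] for maps into a normed space, where limits are unique. *)
Definition strictly_continuous (V : normedModType R[i]) (l : multiplier T -> V) :=
  linear l /\ forall (F : set_system (multiplier T)) m, ProperFilter F ->
    F [set x | mball x] -> mball m -> strict_cvg F id m ->
    l x @[x --> F] --> l m.

(** Norm convergence to [0] in [T] is strict convergence inside the unit ball; this converts strict
    continuity into norm continuity at [0]. *)
Lemma mult_of_cvg0 :
  [/\ ProperFilter (mult_of x @[x --> (0 : T)]),
      (mult_of x @[x --> (0 : T)]) [set m | mball m], mball (0 : multiplier T) &
      forall a, (lact (mult_of x) a @[x --> (0 : T)] --> (0 : T)) /\
                (ract (mult_of x) a @[x --> (0 : T)] --> (0 : T))].
Proof.
split.
- exact: fmap_proper_filter.
- apply/nbhs_norm0P; exists 1 => //= x /= x1 y /=.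
  by rewrite (le_trans (norm_amul_le _ _)) // ler_piMl // ltW.
- by move=> x; rewrite /= normr0.
- move=> a; split=> /=.
    rewrite -[X in _ --> X](amul0x a).
    exact: (bounded_linear_cvg _ (bounded_linear_amulr a)).
  rewrite -[X in _ --> X](amulx0 a).
  exact: (bounded_linear_cvg _ (bounded_linear_amull a)).
Qed.

Lemma strictly_continuous_bounded (V : normedModType R[i])
    (l : multiplier T -> V) :
  strictly_continuous l -> bounded_linear (fun x => l (mult_of x)).
Proof.
move=> [ll lc]; apply: linear_continuous0_bounded.
  by move=> k x y; rewrite linear_mult_of ll.
have [FF Fb b0 Fc] := mult_of_cvg0.
by rewrite -(lin0 ll); exact: (lc (mult_of x @[x --> (0 : T)]) 0 FF Fb b0 Fc).
Qed.

End MultiplierBounds.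

Lemma bounded_mult_lact (R : realType) (T : cstarAlgType R) (m : multiplier T) :
  bounded_mult m -> bounded_linear (lact m).
Proof.
by move=> [M M0 mM]; split; [exact: lact_linear|exists M => //; exact: ltW].
Qed.

Section StrictDensity.
Variables (R : realType) (A B T : cstarAlgType R) (t : A -> B -> T).
Hypothesis tP : is_cstar_tensor t.
Variables (X : Type) (F : set_system X) (u : X -> T).
Hypotheses (FF : ProperFilter F) (uP : approx_unit F u).

(* A bounded multiplier [m] is the strict limit of the [m u i], which lie in
   [T] and stay in a fixed ball. *)
Lemma strictly_continuous_eq (V : normedModType R[i]) (l l' : multiplier T -> V) :
  strictly_continuous l -> strictly_continuous l' ->
  (forall a b, l (mult_of (t a b)) = l' (mult_of (t a b))) ->
  forall m, bounded_mult m -> l m = l' m.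
Proof.
move=> lc lc' ll' m [M M0 mM].
have ET x : l (mult_of x) = l' (mult_of x).
  exact: (bounded_linear_eq tP (strictly_continuous_bounded lc)
    (strictly_continuous_bounded lc') ll' x).
have mb : mball (M^-1 *: m).
  move=> x /=; rewrite normrZ gtr0_norm ?invr_gt0 //.
  by rewrite -(@ler_pM2l _ M) // mulrA divff ?gt_eqF // mul1r.
have [n nE] : exists n, n = M^-1 *: m by exists (M^-1 *: m).
rewrite -nE in mb; have mE : m = M *: n by rewrite nE scalerA divff ?gt_eqF // scale1r.
suff ln : l n = l' n by rewrite mE (linZ lc.1) (linZ lc'.1) ln.
pose G := mult_of (lact n (u i)) @[i --> F].
have GF : ProperFilter G by exact: fmap_proper_filter.
have Gb : G [set x | mball x].
  suff : \forall i \near F, mball (mult_of (lact n (u i))) by [].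
  apply: nearW => i x /=.
  rewrite -lact_amul (le_trans (mb _)) // (le_trans (norm_amul_le _ _)) //.
  by rewrite ler_piMl // uP.1.
have Gc : strict_cvg G id n.
  move=> a; split.
    rewrite (_ : _ @ _ = lact n (u i ** a) @[i --> F]); last first.
      by congr (_ @ F); apply/funext => i /=; rewrite lact_amul.
    apply: bounded_linear_cvg (uP.2 a).1.
    by apply: bounded_mult_lact; exists 1 => // x; rewrite mul1r.
  rewrite (_ : _ @ _ = (ract n a ** u i) @[i --> F]); last first.
    by congr (_ @ F); apply/funext => i /=; rewrite lractP.
  exact: (uP.2 (ract n a)).2.
have h := lc.2 G n GF Gb mb Gc; have h' := lc'.2 G n GF Gb mb Gc.
apply: (cvg_unique (@norm_hausdorff _ _) h).
suff -> : l x @[x --> G] = l' x @[x --> G] by [].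
by rewrite /G; congr (_ @ F); apply/funext => i /=; exact: ET.
Qed.

End StrictDensity.

(** * Automatic boundedness of star-homomorphisms into multipliers *)

Section Contractive.
Variable R : realType.

(** The order on [R[i]] forces [q] and [r] to be real, which reduces the claim to a real geometric
    sequence. *)
Lemma expr_small (q r : R[i]) : 0 <= q -> q < 1 -> 0 < r ->
  exists n, q ^+ n < r.
Proof.
case: q r => [q qi] [r ri]; rewrite !lecE !ltcE /= => /andP[/eqP -> q0].
move=> /andP[_ q1] /andP[/eqP -> r0].
have qn : `|q| < 1 by rewrite ger0_norm.
move/cvgr0Pnorm_lt: (cvg_expr qn) => /(_ _ r0) [N _ /(_ N (leqnn N)) qN].
exists N; rewrite -[_ +i* _]/(q%:C) -[_ +i* _ in ltRHS]/(r%:C).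
rewrite -rmorphXn ltcR; apply: le_lt_trans qN; exact: ler_norm.
Qed.

Section StarHom.
Variables (A T : cstarAlgType R) (f : A -> multiplier T).
Hypothesis fh : star_hom f.

(** The C*-identity for [f(a) x], whose square is [star x ** f(star a ** a) x]. *)
Lemma norm_lact_star_hom a x :
  `|lact (f a) x| ^+ 2 <= `|x| * `|lact (f (star a ** a)) x|.
Proof.
have [_ fM fS] := fh.
rewrite -norm_star_amul lact_star -lractP.
rewrite fM fS -[in leRHS](norm_star x); exact: norm_amul_le.
Qed.

(* If [|f(a) x| > |x|], then [|f(h ^ 2 ^ n) x| > |x|] for [h = star a ** a] and
   all [n], although these powers tend to [0]. *)
Lemma star_hom_ball :
  (forall x, lact (f a) x @[a --> (0 : A)] --> (0 : T)) ->
  forall a, `|a| < 1 -> mball (f a).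
Proof.
move=> f0 a a1 x; rewrite real_leNgt ?normr_real //; apply/negP => ax.
have [_ fM fS] := fh.
pose h n := iter n (fun y => y ** y) (star a ** a).
have hS n : star (h n) = h n.
  by elim: n => [|n IH] /=; rewrite starM ?starK // -/(h n) IH.
(* A crude exponent, growing linearly instead of exponentially, still tends to [0]. *)
have hN n : `|h n| <= `|a| ^+ n.+1.
  elim: n => [|n IH] /=.
    by rewrite norm_star_amul expr1 expr2 ler_piMl // ltW.
  rewrite (le_trans (norm_amul_le _ _)) // -/(h n).
  rewrite (le_trans (ler_pM _ _ IH IH)) // -exprD ler_wiXn2l //; last first.
    by rewrite addSn ltnS leq_addl.
  exact: ltW.
have x0 : 0 < `|x|.
  rewrite normr_gt0; apply/eqP => x0; move: ax.
  by rewrite x0 (lin0 (lact_linear _)) !normr0 ltxx.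
have key b : `|x| < `|lact (f b) x| -> `|x| < `|lact (f (star b ** b)) x|.
  move=> bx; rewrite -(@ltr_pM2l _ `|x|) //.
  apply: lt_le_trans (norm_lact_star_hom b x).
  by rewrite expr2 ltr_pM.
have hx n : `|x| < `|lact (f (h n)) x|.
  elim: n => [|n IH]; first exact: key.
  by rewrite /= -/(h n) -{1}(hS n); exact: key.
move/cvgr0Pnorm_lt: (f0 x) => /(_ _ x0) /nbhs_norm0P [r /= r0 fr].
have [n nr] := expr_small (normr_ge0 a) a1 r0.
have := fr (h n); rewrite /= => hr.
have : `|h n| < r.
  apply: le_lt_trans nr; rewrite (le_trans (hN n)) // exprS ler_piMl //.
  exact: ltW.
by move=> /hr /(lt_trans (hx n)); rewrite ltxx.
Qed.

Lemma star_hom_bounded :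
  (forall x, lact (f a) x @[a --> (0 : A)] --> (0 : T)) ->
  forall a, bounded_mult (f a).
Proof.
(* Dividing by [|a| + 1] lands in the open unit ball, also when [a = 0]. *)
move=> f0 a; have a1 : 0 < `|a| + 1 by rewrite ltr_wpDl.
have := star_hom_ball f0 (a := (`|a| + 1)^-1 *: a).
rewrite normrZ gtr0_norm ?invr_gt0 // mulrC ltr_pdivrMr // mul1r ltrDl ltr01.
move=> /(_ isT) fb; exists (`|a| + 1) => // x.
have [lf _ _] := fh.
have := fb x; rewrite (linZ lf) /= normrZ gtr0_norm ?invr_gt0 //.
by rewrite mulrC ler_pdivrMr // mulrC.
Qed.

End StarHom.

Lemma strict_hom_cvg0 (A T : cstarAlgType R) (f : A -> multiplier T) (x : T) :
  strict_hom f -> lact (f a) x @[a --> (0 : A)] --> (0 : T).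
Proof.
move=> [[lf _ _] fs]; have [FF Fb b0 Fc] := @mult_of_cvg0 R A.
have E0 : mult_of (0 : A) = 0 := lin0 (@linear_mult_of R A).
have := fs (nbhs (0 : A)) 0 _ Fb.
rewrite E0 => /(_ _ b0 Fc x) [+ _].
by rewrite (lin0 lf).
Qed.

Lemma strict_hom_bounded (A T : cstarAlgType R) (f : A -> multiplier T) :
  strict_hom f -> forall a, bounded_mult (f a).
Proof.
by move=> fS; apply: star_hom_bounded fS.1 _ => x; exact: strict_hom_cvg0.
Qed.

End Contractive.

(** * Direct sums of matrix algebras *)

(** Such a [q] reduces slicing a multiplier [m] by [w] to slicing the element [m (1 (x) q)]. *)
Definition local_unit (R : realType) (B : cstarAlgType R) (w : B -> R[i])
    (q : B) :=
  [/\ forall b, q ** b = b ** q, forall b, w (q ** b) = w b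
    & forall b, w (b ** q) = w b].

Section MatrixSum.
Variables (R : realType) (I : choiceType) (d : I -> nat) (B : cstarAlgType R).
Variable c : forall x, B -> 'M[R[i]]_(d x).
Hypothesis cP : c0_matrix_sum c.

Lemma opnorm_le0 n (r : R[i]) : 0 <= r -> opnorm_le (0 : 'M[R[i]]_n) r.
Proof.
move=> r0 v; rewrite mul0mx big1 => [|i _]; last by rewrite mxE normr0 expr0n.
by rewrite mulr_ge0 ?exprn_ge0 // sumr_ge0 // => i _; rewrite exprn_ge0.
Qed.

Lemma coord_inj a b : (forall x, c x a = c x b) -> a = b.
Proof.
move=> ab; apply/eqP; rewrite -subr_eq0 -normr_le0.
apply/(c0_norm cP _ (lexx 0)) => x.
by rewrite (linB (c0_linear cP x)) ab subrr; exact: opnorm_le0.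
Qed.

(** Indices are compared as natural numbers because those of block [y] and of block [x] have
    different types. *)
Lemma block_unit_subproof x (i j : 'I_(d x)) : exists a, forall y,
  c y a = \matrix_(k, l) ((y == x) && ((k == i :> nat) && (l == j :> nat)))%:R.
Proof.
apply: (c0_full cP) => r r0; apply: sub_finite_set (finite_set1 x) => y.
rewrite /mkset => yr; apply: contra_notP yr => /eqP/negPf yx.
rewrite (_ : \matrix_(_, _) _ = 0); first exact/opnorm_le0/ltW.
by apply/matrixP => k l; rewrite !mxE yx.
Qed.

Definition block_unit x i j := projT1 (cid (@block_unit_subproof x i j)).

Lemma coord_block_unit x i j : c x (block_unit i j) = delta_mx i j.
Proof.
rewrite /block_unit; case: cid => a /= ->; apply/matrixP => k l.
by rewrite !mxE eqxx.
Qed.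

Lemma coord_block_unit_neq x y i j : y != x ->
  c y (@block_unit x i j) = 0.
Proof.
move=> /negPf yx; rewrite /block_unit; case: cid => a /= ->.
by apply/matrixP => k l; rewrite !mxE yx.
Qed.

Lemma block_unit_sandwich x (i j : 'I_(d x)) b :
  block_unit i i ** b ** block_unit j i = c x b i j *: block_unit i i.
Proof.
apply: coord_inj => y; rewrite !(c0_mul cP) (linZ (c0_linear cP y)).
have [yx|yx] := eqVneq y x; last first.
  by rewrite !coord_block_unit_neq // mulmx0 scaler0.
subst y; rewrite !coord_block_unit; apply/matrixP => k l.
rewrite !mxE (bigD1 j) //= !mxE (bigD1 i) //= !mxE !eqxx !andbT /=.
rewrite big1 => [|m /negPf mi]; last by rewrite !mxE mi andbF mul0r.
rewrite big1 => [|m /negPf mj]; last by rewrite !mxE mj mulr0.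
rewrite !addr0 mulrAC mulrC -natrM mulnb.
by rewrite mulrC.
Qed.

Lemma block_proj_subproof (K : {fset I}) : exists a, forall y,
  c y a = if y \in K then 1%:M else 0.
Proof.
apply: (c0_full cP) => r r0.
apply: sub_finite_set (finite_fset K) => y.
rewrite /mkset => yr; apply: contra_notP yr => /negP/negPf ->.
exact/opnorm_le0/ltW.
Qed.

Definition block_proj K := projT1 (cid (block_proj_subproof K)).

Lemma coord_block_proj K x : c x (block_proj K) = if x \in K then 1%:M else 0.
Proof. by rewrite /block_proj; case: cid. Qed.

Lemma block_projC K b : block_proj K ** b = b ** block_proj K.
Proof.
apply: coord_inj => x; rewrite !(c0_mul cP) coord_block_proj.
by case: ifP; rewrite ?mul1mx ?mulmx1 ?mul0mx ?mulmx0.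
Qed.

(** By [c0_vanish] only finitely many blocks of [b] have norm above [e]; once [K] contains them, the
    error is [0] on [K] and small elsewhere. *)
Lemma approx_unit_block_proj : approx_unit totally block_proj.
Proof.
have appr b : block_proj K ** b @[K --> totally] --> b.
  apply/cvgrPdist_le => e e0.
  have /finite_fsetP[K0 K0E] := c0_vanish cP b e0.
  exists K0 => // K /= K0K; apply/(c0_norm cP _ (ltW e0)) => x.
  rewrite (linB (c0_linear cP x)) (c0_mul cP) coord_block_proj.
  case: ifPn => xK; first by rewrite mul1mx subrr; exact/opnorm_le0/ltW.
  rewrite mul0mx subr0; apply: contra_notP (negP xK) => xe.
  apply: (fsubsetP K0K).
  suff : [set` K0] x by [].
  by rewrite -K0E.
split=> [K|b]; last by under [in X in _ /\ X]eq_fun do rewrite -block_projC.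
apply/(c0_norm cP _ ler01) => x; rewrite coord_block_proj.
case: ifP => _; last exact: opnorm_le0.
by move=> v; rewrite mul1mx expr1n mul1r.
Qed.

Lemma block_proj_decomp K b : block_proj K ** b =
  \sum_(x <- enum_fset K) \sum_i \sum_j c x b i j *: block_unit i j.
Proof.
apply: coord_inj => y; rewrite (c0_mul cP) coord_block_proj.
rewrite (lin_sum (c0_linear cP y)).
have zero x : x != y -> c y (\sum_i \sum_j c x b i j *: block_unit i j) = 0.
  move=> xy; rewrite (lin_sum (c0_linear cP y)) big1 // => i _.
  rewrite (lin_sum (c0_linear cP y)) big1 // => j _.
  by rewrite (linZ (c0_linear cP y)) coord_block_unit_neq 1?eq_sym // scaler0.
case: ifPn => yK; last first.
  rewrite mul0mx big_seq big1 // => x xK; apply: zero.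
  by apply: contraNneq yK => <-.
rewrite mul1mx (bigD1_seq y) //= ?fset_uniq //.
rewrite [X in _ + X]big1 ?addr0; last by move=> x; exact: zero.
rewrite (lin_sum (c0_linear cP y)) {1}[c y b]matrix_sum_delta.
apply: eq_bigr => i _; rewrite (lin_sum (c0_linear cP y)).
apply: eq_bigr => j _.
by rewrite (linZ (c0_linear cP y)) coord_block_unit.
Qed.

(** * Functionals of finite support and their slices *)

Section Functional.
Variable w : B -> R[i].
Hypotheses (wb : bounded_functional w) (wf : finitely_supported c w).

Lemma functional_bounded_linear : bounded_linear (w : B -> R[i]^o).
Proof.
have [lw [r wr]] := wb; split=> //; exists `|r| => // x.
rewrite -[in leRHS](normr_id x) -normrM ger0_norm ?wr //.
exact: le_trans (wr x).
Qed.

(** Since [w] kills the matrix units outside its support [K0], the values [w (block_proj L ** b)]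
    are constant for [L] above [K0], while they converge to [w b]. *)
Lemma functional_block_proj : exists K0 : {fset I}, forall K : {fset I},
  (K0 `<=` K)%fset -> forall b, w (block_proj K ** b) = w b.
Proof.
have /finite_fsetP[K0 K0E] := wf; exists K0 => K K0K b.
have lw := functional_bounded_linear.1.
have wE L : w (block_proj L ** b) =
    \sum_(x <- enum_fset L) \sum_i \sum_j c x b i j * w (block_unit i j).
  rewrite block_proj_decomp (lin_sum lw); apply: eq_bigr => x _.
  rewrite (lin_sum lw); apply: eq_bigr => i _.
  by rewrite (lin_sum lw); apply: eq_bigr => j _; rewrite (linZ lw).
have w0 x (i j : 'I_(d x)) : x \notin K0 -> w (block_unit i j) = 0.
  move=> xK0; apply: contra_notP (negP xK0) => wx.
  suff : [set` K0] x by [].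
  rewrite -K0E; exists (block_unit i j); split=> // y /eqP.
  exact: coord_block_unit_neq.
have wK0 L : (K0 `<=` L)%fset -> w (block_proj L ** b) = w (block_proj K0 ** b).
  move=> K0L; rewrite !wE; apply/esym.
  apply: big_fset_incl => // x _ xK0.
  by rewrite big1 // => i _; rewrite big1 // => j _; rewrite w0 // mulr0.
have [_ /(_ b)[pb _]] := approx_unit_block_proj.
have h1 : (w (block_proj L ** b) : R[i]^o) @[L --> totally] --> (w b : R[i]^o).
  exact: bounded_linear_cvg functional_bounded_linear pb.
have h2 : (w (block_proj L ** b) : R[i]^o) @[L --> totally] -->
    (w (block_proj K ** b) : R[i]^o).
  apply: cvg_near_cst; exists K0 => // L /= K0L.
  by rewrite /= (wK0 _ K0L) (wK0 _ K0K).
exact: (cvg_unique (@norm_hausdorff _ R[i]^o) h2 h1).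
Qed.

Lemma local_unit_block_proj : exists K0 : {fset I}, forall K : {fset I},
  (K0 `<=` K)%fset -> local_unit w (block_proj K).
Proof.
have [K0 K0P] := functional_block_proj; exists K0 => K K0K.
by split=> b; rewrite -?block_projC ?K0P.
Qed.

Variables (A T : cstarAlgType R) (t : A -> B -> T).
Hypothesis tP : is_cstar_tensor t.

(** With matrix units [e_ij] and the slice [a] of [v], one has [(y a z) (x) e_ii = (y (x) e_ii) v (z
    (x) e_ji)]. This realises the slice by multiplication in [T]; the norm of [e_ii] cancels. *)
Lemma coord_slice_le x (i j : 'I_(d x)) (s : seq (A * B)) :
  `|\sum_(p <- s) c x p.2 i j *: p.1| <=
  `|block_unit j i| * `|\sum_(p <- s) t p.1 p.2|.
Proof.
apply: norm_le_sandwich; first exact: mulr_ge0.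
move=> y z; set v := \sum_(p <- s) t _ _.
have u0 : 0 < `|block_unit i i|.
  rewrite normr_gt0; apply/eqP => u0.
  have := coord_block_unit i i; rewrite u0 (lin0 (c0_linear cP x)).
  by move/matrixP => /(_ i i)/eqP; rewrite !mxE !eqxx /= eq_sym oner_eq0.
rewrite -(@ler_pM2r _ `|block_unit i i|) // -(ct_norm tP).
have -> : t (y ** (\sum_(p <- s) c x p.2 i j *: p.1) ** z) (block_unit i i) =
    t y (block_unit i i) ** v ** t z (block_unit j i).
  rewrite amul_sumr !amul_suml amul_sumr amul_suml.
  rewrite (lin_sum (ct_linearl tP _)); apply: eq_bigr => p _.
  rewrite !(ct_mul tP) block_unit_sandwich amulZr amulZl.
  by rewrite (linZ (ct_linearl tP _)) (linZ (ct_linearr tP _)).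
rewrite (le_trans (norm_amul_le _ _)) // (ct_norm tP z).
rewrite (le_trans (ler_wpM2r _ (norm_amul_le _ _))) ?mulr_ge0 //.
rewrite (ct_norm tP y) le_eqVlt; apply/orP; left; apply/eqP.
by ring.
Qed.

Lemma slice_exists : exists S : T -> A, bounded_linear S /\
  forall a b, S (t a b) = w b *: a.
Proof.
have [K0 /(_ K0 (fsubset_refl K0)) wK0] := functional_block_proj.
have lw := functional_bounded_linear.1.
(* On the support, [w] is the combination of matrix entries with weights [w (block_unit i j)]; each
   entry contributes the bound of [coord_slice_le]. *)
pose M := \sum_(x <- enum_fset K0) \sum_i \sum_j
  `|w (block_unit i j)| * `|@block_unit x j i|.
apply: (bounded_slice tP (M := M)) => //.
  by do 3 (apply: sumr_ge0 => ? _); exact: mulr_ge0.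
move=> s.
have wZ k u (a : A) : w (k *: u) *: a = w u *: (k *: a).
  by rewrite (linZ lw) scalerA mulrC.
have -> : \sum_(p <- s) w p.2 *: p.1 =
    \sum_(x <- enum_fset K0) \sum_i \sum_j
      w (@block_unit x i j) *: \sum_(p <- s) c x p.2 i j *: p.1.
  under eq_bigr => p _.
    rewrite -wK0 block_proj_decomp (lin_sum lw) scaler_suml.
    under eq_bigr => x _.
      rewrite (lin_sum lw) scaler_suml.
      under eq_bigr => i _.
        rewrite (lin_sum lw) scaler_suml.
        under eq_bigr => j _ do rewrite wZ.
        over.
      over.
    over.
  rewrite exchange_big /=; apply: eq_bigr => x _.
  rewrite exchange_big /=; apply: eq_bigr => i _.
  rewrite exchange_big /=; apply: eq_bigr => j _.
  by rewrite scaler_sumr.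
rewrite (le_trans (ler_norm_sum _ _ _)) // /M mulr_suml ler_sum // => x _.
rewrite (le_trans (ler_norm_sum _ _ _)) // mulr_suml ler_sum // => i _.
rewrite (le_trans (ler_norm_sum _ _ _)) // mulr_suml ler_sum // => j _.
by rewrite normrZ -mulrA ler_wpM2l // coord_slice_le.
Qed.

End Functional.
End MatrixSum.

(** * Slice maps *)

Section StrictlyContinuous.
Variables (R : realType) (T : cstarAlgType R).

Lemma strictly_continuous_lact (z : T) :
  strictly_continuous (fun m : multiplier T => lact m z).
Proof. by split=> // F m FF Fb mb Fm; exact: (Fm z).1. Qed.

Lemma strictly_continuous_comp (V W : normedModType R[i]) (f : V -> W)
    (l : multiplier T -> V) :
  bounded_linear f -> strictly_continuous l ->
  strictly_continuous (fun m => f (l m)).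
Proof.
move=> fb [ll lc]; split; first by move=> k m n; rewrite ll fb.1.
move=> F m FF Fb mb Fm; exact: bounded_linear_cvg fb (lc F m FF Fb mb Fm).
Qed.

Lemma strictly_continuous_strict (D : cstarAlgType R)
    (f : multiplier T -> multiplier D) (z : D) :
  linear f -> strict_on_ball id f -> strictly_continuous (fun m => lact (f m) z).
Proof.
move=> lf fs; split; first by move=> k m n; rewrite lf.
by move=> F m FF Fb mb Fm; exact: (fs F m FF Fb mb Fm z).1.
Qed.

End StrictlyContinuous.

Lemma bounded_linear_scaler (R : realType) (A : cstarAlgType R)
    (w : A -> R[i]) (V : normedModType R[i]) (v : V) :
  bounded_linear (w : A -> R[i]^o) -> bounded_linear (fun x => w x *: v).
Proof.
move=> [lw [M M0 wM]]; split.
  by move=> k x y; rewrite lw scalerDl scalerA.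
exists (M * `|v|); first exact: mulr_ge0.
by move=> x; rewrite normrZ mulrAC ler_wpM2r.
Qed.

Section Slice.
Variables (R : realType) (A B T : cstarAlgType R) (t : A -> B -> T).
Hypothesis tP : is_cstar_tensor t.

(** The slice map on [T] itself, in contrast to [is_id_slice], which lives on multipliers. *)
Definition is_slice (w : B -> R[i]) (S : T -> A) :=
  bounded_linear S /\ forall a b, S (t a b) = w b *: a.

Lemma slice_unique w S S' : is_slice w S -> is_slice w S' -> S =1 S'.
Proof.
by move=> [Sb SE] [S'b S'E]; apply: (bounded_linear_eq tP) => // a b; rewrite SE.
Qed.

Lemma sliceZD k v w S S' S'' : is_slice v S -> is_slice w S' ->
  is_slice (fun b => k * v b + w b) S'' -> forall x, S'' x = k *: S x + S' x.
Proof.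
move=> [Sb SE] [S'b S'E] S''P; apply: slice_unique S''P _.
split; first exact: bounded_linearZD.
by move=> a b; rewrite SE S'E scalerDl scalerA.
Qed.

(** Both sides are bounded in [x] and in [y] separately; on elementary tensors the claim is the
    coproduct formula for [w]. *)
Lemma slice_amul (J : Type) (r : seq J) (w : B -> R[i]) (w1 w2 : J -> B -> R[i])
    S S1 S2 :
  is_slice w S -> (forall i, is_slice (w1 i) (S1 i)) ->
  (forall i, is_slice (w2 i) (S2 i)) ->
  (forall a b, \sum_(i <- r) w1 i a * w2 i b = w (a ** b)) ->
  forall x y, S (x ** y) = \sum_(i <- r) S1 i x ** S2 i y.
Proof.
move=> [Sb SE] S1P S2P wE x y.
have sumb (V : normedModType R[i]) (f : J -> T -> V) :
    (forall i, bounded_linear (f i)) ->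
    bounded_linear (fun x => \sum_(i <- r) f i x).
  move=> fb; have := bounded_linear_sum r (fun=> 1) fb.
  suff -> : (fun x => \sum_(i <- r) 1 *: f i x) =
            (fun x => \sum_(i <- r) f i x) by [].
  by apply/funext => z; apply: eq_bigr => i _; rewrite scale1r.
move: x; apply: (bounded_linear_eq tP).
- exact: bounded_linear_comp Sb (bounded_linear_amulr y).
- apply: sumb => i.
  by apply: bounded_linear_comp (bounded_linear_amulr _) _; exact: (S1P i).1.
move=> a b; move: y; apply: (bounded_linear_eq tP).
- exact: bounded_linear_comp Sb (bounded_linear_amull _).
- apply: sumb => i.
  by apply: bounded_linear_comp (bounded_linear_amull _) _; exact: (S2P i).1.
move=> a' b'; rewrite (ct_mul tP) SE -wE scaler_suml.
apply: eq_bigr => i _; rewrite (S1P i).2 (S2P i).2.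
by rewrite amulZl amulZr scalerA.
Qed.

Section LocalUnit.
Variables (w : B -> R[i]) (S : T -> A) (q : B).
Hypotheses (SP : is_slice w S) (wq : local_unit w q).

Lemma slice_amulr x a : S (x ** t a q) = S x ** a.
Proof.
have [Sb SE] := SP; have [_ _ wr] := wq.
move: x; apply: (bounded_linear_eq tP).
- exact: bounded_linear_comp Sb (bounded_linear_amulr _).
- exact: bounded_linear_comp (bounded_linear_amulr _) Sb.
- by move=> a' b; rewrite (ct_mul tP) !SE wr amulZl.
Qed.

Lemma slice_amull x a : S (t a q ** x) = a ** S x.
Proof.
have [Sb SE] := SP; have [_ wl _] := wq.
move: x; apply: (bounded_linear_eq tP).
- exact: bounded_linear_comp Sb (bounded_linear_amull _).
- exact: bounded_linear_comp (bounded_linear_amull _) Sb.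
- by move=> a' b; rewrite (ct_mul tP) !SE wl amulZr.
Qed.

(** Testing against [y] from the left inserts [t y q], on which [p] acts from the right through [m]
    alone. *)
Lemma slice_mtens (m : multiplier A) (p : multiplier T) x :
  is_mtens t m (mone B) p -> S (lact p x) = lact m (S x).
Proof.
move=> pE; apply: amul_injr => y.
by rewrite -slice_amull !lractP (pE y q).2 slice_amull.
Qed.

End LocalUnit.

Lemma is_mtens_star m n p : is_mtens t m n p ->
  is_mtens t (star m) (star n) (star p).
Proof.
by move=> pE a b; rewrite /= !(ct_star tP) (pE _ _).1 (pE _ _).2 !(ct_star tP).
Qed.

Section UnitalSlice.
Variable one : A.
Hypothesis oneP : is_unit one.

Lemma unit_tens_central q : (forall b, q ** b = b ** q) ->
  forall x, t one q ** x = x ** t one q.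
Proof.
move=> qC; apply: (bounded_linear_eq tP).
- exact: bounded_linear_amull.
- exact: bounded_linear_amulr.
- by move=> a b; rewrite !(ct_mul tP) qC (oneP a).1 (oneP a).2.
Qed.

(** Both [1 (x) q] and [1 (x) q'] can be inserted under [S]; they commute, and either one can then
    be dropped. *)
Lemma slice_local_unit w S q q' : is_slice w S ->
  local_unit w q -> local_unit w q' ->
  forall m, S (lact m (t one q)) = S (lact m (t one q')).
Proof.
move=> SP wq wq' m; have [qC _ _] := wq.
rewrite -[LHS](oneP _).2 -(slice_amulr SP wq') -lact_amul.
by rewrite unit_tens_central // lact_amul (slice_amulr SP wq) (oneP _).2.
Qed.

(** Inserting [1 (x) q] on the left replaces [m] by an element of [T], to which [slice_amul]
    applies; under each [S1 i] that element may be traded for [m (1 (x) q)]. *)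
Lemma slice_lact_amul (J : eqType) (r : seq J) (w : B -> R[i])
    (w1 w2 : J -> B -> R[i]) S S1 S2 q :
  is_slice w S -> (forall i, is_slice (w1 i) (S1 i)) ->
  (forall i, is_slice (w2 i) (S2 i)) ->
  (forall a b, \sum_(i <- r) w1 i a * w2 i b = w (a ** b)) ->
  local_unit w q -> (forall i, i \in r -> local_unit (w1 i) q) ->
  forall m x, S (lact m x) = \sum_(i <- r) S1 i (lact m (t one q)) ** S2 i x.
Proof.
move=> SP S1P S2P wE wq w1q m x.
rewrite -[LHS](oneP _).1 -(slice_amull SP wq) lractP.
rewrite (slice_amul SP S1P S2P wE).
apply: eq_big_seq => i /w1q w1iq; congr (_ ** _).
rewrite -[LHS](oneP _).2 -(slice_amulr (S1P i) w1iq) -lractP.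
by rewrite (slice_amull (S1P i) w1iq) (oneP _).1.
Qed.

Lemma star_unit : star one = one.
Proof. by rewrite -[LHS](oneP _).1 -{1}[one]starK -starM (oneP _).1 starK. Qed.

(** The norm of [one] is idempotent, hence [0] or [1]; the value [0] is the zero algebra. *)
Lemma norm_unit_le1 : `|one| <= 1.
Proof.
have := norm_star_amul one; rewrite star_unit (oneP one).1 expr2.
have [->|o0] := eqVneq `|one| 0; first by rewrite ler01.
by rewrite -{1}[ `|one| ]mulr1 => /(mulfI o0) <-.
Qed.

Lemma approx_unit_one (X : Type) (F : set_system X) (FF : Filter F) :
  approx_unit F (fun=> one).
Proof.
split=> [_|a]; first exact: norm_unit_le1.
have [-> ->] := oneP a; split; exact: cvg_cst.
Qed.

Lemma unit_mult_of : mult_of one = mone A.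
Proof. by apply: multiplierP => x /=; have [] := oneP x. Qed.

End UnitalSlice.
End Slice.

(** * The discrete dual *)

Section DiscreteDual.
Variables (R : realType) (G : compactQG R) (H : hopfAlg R[i]) (e : H -> G).
Variables (B : cstarBialg R) (D : discrete_dual e B).

Local Notation pair := (dd_pair D).
(** Finite sets of blocks need a choice structure on the index type, supplied here classically. *)
Local Notation Irr := {classic (dd_irr D)}.
Local Notation dim := (fun x : Irr => irr_dim (x : dd_irr D)).
Local Notation coord := (fun x : Irr => dd_coord (x : dd_irr D)).

Let cP : @c0_matrix_sum R Irr dim B coord := dd_coordP D.

Definition support_proj (K : {fset Irr}) : B := block_proj cP K.

Lemma approx_unit_support_proj : approx_unit totally support_proj.
Proof. exact: approx_unit_block_proj. Qed.

Lemma bounded_linear_pair h : bounded_linear (pair h : B -> R[i]^o).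
Proof. exact: functional_bounded_linear (dd_pair_functional D h).1. Qed.

Lemma pair_slice h (A T : cstarAlgType R) (t : A -> B -> T) :
  is_cstar_tensor t -> exists S, is_slice t (pair h) S.
Proof.
have [hb hf] := dd_pair_functional D h.
exact: (@slice_exists _ _ _ _ _ cP _ hb hf).
Qed.

Lemma pair_local_unit (r : seq H) :
  exists q, forall h, h \in r -> local_unit (pair h) q.
Proof.
(* Asking for every larger [K] lets the induction take unions of supports. *)
suff [K0 K0P] : exists K0 : {fset Irr}, forall K : {fset Irr}, (K0 `<=` K)%fset ->
    forall h, h \in r -> local_unit (pair h) (support_proj K).
  by exists (support_proj K0) => h; apply: K0P.
elim: r => [|g r [K0 K0P]]; first by exists fset0.
have [gb gf] := dd_pair_functional D g.
have [K1 K1P] := @local_unit_block_proj _ _ _ _ _ cP _ gb gf.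
exists (K1 `|` K0)%fset => K; rewrite fsubUset => /andP[K1K K0K] h.
by rewrite inE => /predU1P[->|]; [exact: K1P|exact: K0P].
Qed.

Lemma counit_neq0 (w : B -> R[i]) : is_counit w -> exists b : B, b != 0.
Proof.
move=> [[lw _ _ [b wb]] _]; exists b; apply: contraNneq wb => ->.
by rewrite (lin0 (lw : linear (w : B -> R[i]^o))).
Qed.

(* [Delta (x) id] is norm continuous, being strictly continuous. *)
Lemma comul_bounded b : bounded_mult (comul b : multiplier (bi_tens B)).
Proof.
have [c0 c00] := counit_neq0 (dd_pair1 D).
have [f [_ [[[[lf _ _] fs] fE] _ _]]] := comul_coassoc B.
have N0 : 0 < `|star c0 ** c0| by rewrite norm_star_amul exprn_gt0 ?normr_gt0.
apply: star_hom_bounded b; first exact: comul_hom.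
move=> x; set t3 := tens12_3 (bi_tens3 B) in fE.
have t3P : is_cstar_tensor t3 := (tens12_3P (bi_tens3 B)).1.
have fx := bounded_linear_comp
  (strictly_continuous_bounded (strictly_continuous_strict (t3 x c0) lf fs))
  (bounded_linear_tensl (tensP (bi_tens B)).1 (star c0)).
have fx0 := bounded_linear_cvg _ fx (@cvg_id _ (nbhs (0 : B))).
have {}fx0 : lact (f (mult_of (tens (bi_tens B) a (star c0)))) (t3 x c0)
    @[a --> (0 : B)] --> 0.
  by rewrite -[X in _ --> X](lin0 fx.1); exact: fx0.
apply: (cvg_norm_le _ (M := `|star c0 ** c0|^-1) _ _ fx0).
  by rewrite invr_ge0.
by move=> a; rewrite (fE a (star c0) x c0).1 (ct_norm t3P) mulrC mulfK // gt_eqF.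
Qed.

(** The strict slice sends [x (x) star c0] to [w x *: star c0]; evaluating at [c0] bounds [w x]
    times a nonzero norm. *)
Lemma counit_bounded (w : B -> R[i]) : is_counit w ->
  bounded_linear (w : B -> R[i]^o).
Proof.
move=> wc; have [c0 c00] := counit_neq0 wc.
have [[lw _ _ _] [s [_ [[ls ss sE] _ _]]]] := wc.
split=> //.
have := strictly_continuous_bounded (strictly_continuous_strict c0 ls ss).
move=> [_ [M M0 sM]].
have N0 : 0 < `|star c0 ** c0| by rewrite norm_star_amul exprn_gt0 ?normr_gt0.
exists (M * `|star c0| / `|star c0 ** c0|).
  by rewrite divr_ge0 ?mulr_ge0.
move=> x; rewrite mulrAC ler_pdivlMr //.
have := sM (tens (bi_tens B) x (star c0)).
rewrite sE /= amulZl normrZ => /le_trans; apply.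
rewrite (ct_norm (tensP (bi_tens B)).1) mulrA mulrAC.
by rewrite -!mulrA ler_wpM2l.
Qed.

(** By multiplicativity and continuity [w] is nonzero on some projection [p] onto finitely many
    blocks. An element [b] supported on another block has [p ** b = 0], so [w p * w b = 0]. *)
Lemma counit_finitely_supported (w : B -> R[i]) : is_counit w ->
  finitely_supported coord w.
Proof.
move=> wc; have wb := counit_bounded wc; have [[lw wM _ [a wa]] _] := wc.
have h : (w (support_proj K ** a) : R[i]^o) @[K --> totally] --> (w a : R[i]^o).
  have [pa _] := approx_unit_support_proj.2 a.
  exact: (bounded_linear_cvg totally_filter wb pa).
have [K wK] : exists K, w (support_proj K) != 0.
  apply: contrapT => /forallNP w0; have := negP wa; apply; apply/eqP.
  have h0 : (w (support_proj K ** a) : R[i]^o) @[K --> totally] --> (0 : R[i]^o).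
    apply: cvg_near_cst; exists (fset0 : {fset Irr}) => // K _.
    rewrite /= wM.
    by have /negP/negPn/eqP -> := w0 K; rewrite mul0r.
  exact: (cvg_unique (@norm_hausdorff _ R[i]^o) h h0).
apply: sub_finite_set (finite_fset K) => x /= [b [bx]].
apply: contra_notT => xK; apply: (mulfI wK); rewrite mulr0 -wM.
have -> : support_proj K ** b = 0; last first.
  by rewrite (lin0 (lw : linear (w : B -> R[i]^o))).
apply: (coord_inj cP) => y; rewrite (lin0 (c0_linear cP y)) (c0_mul cP).
rewrite (coord_block_proj cP K y); case: ifPn => yK; last by rewrite mul0mx.
by rewrite bx ?mulmx0 // => yx; rewrite -yx yK in xK.
Qed.


(** The abstract extension of the product functional and the concrete truncated slice are both
    strictly continuous and agree on elementary tensors. *)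
Lemma pair_mulE h k S q b : is_slice (tens (bi_tens B)) (pair k) S ->
  local_unit (pair h) q -> local_unit (pair k) q ->
  pair (h * k) b = pair h (S (lact (comul b) (tens (bi_tens B) q q))).
Proof.
move=> SP [_ _ hq] [_ _ kq]; have [s [[ls sc sE] ->]] := dd_pairM D h k.
have tP := (tensP (bi_tens B)).1.
apply: (strictly_continuous_eq tP totally_filter
  (approx_unit_tens tP totally_filter approx_unit_support_proj
    approx_unit_support_proj)
  (V := R[i]^o) (l := s)
  (l' := fun m => pair h (S (lact m (tens (bi_tens B) q q))))).
- by [].
- apply: strictly_continuous_comp (bounded_linear_pair h) _.
  by apply: strictly_continuous_comp SP.1 _; exact: strictly_continuous_lact.
- move=> a a'; rewrite sE /= (ct_mul tP) SP.2 kq.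
  by rewrite (linZ (bounded_linear_pair h).1) hq mulrC.
- exact: comul_bounded.
Qed.

Lemma counit_eq (w : B -> R[i]) : is_counit w -> w = pair 1.
Proof.
move=> wc; have [wlin _] := wc.1; have [M M0 wM] := (counit_bounded wc).2.
have [h hE] : exists h, pair h = w.
  apply: dd_pair_surj; last exact: counit_finitely_supported wc.
  by split=> //; exists M.
suff h1 : h = 1 by rewrite -hE h1.
apply: (dd_pair_inj (d := D)); apply/funext => b.
have [s1 [s2 [[ls1 ss1 s1E] _ s1D]]] := wc.2.
have [s [[ls sc sE]]] := dd_pairM D h 1.
(* Reading [h] as [h * 1] expresses [pair h b] through [w (x) pair 1] at [comul b]; slicing by the
   counit [w] first leaves [pair 1 b]. *)
move=> /(_ b); rewrite mulr1 => ->.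
have [q qP] := pair_local_unit [:: 1]; have [_ _ q1] := qP 1 (mem_head _ _).
have tP := (tensP (bi_tens B)).1.
rewrite -[RHS]q1; have -> : b ** q = lact (s1 (comul b)) q by rewrite (s1D b).1.
apply: (strictly_continuous_eq tP totally_filter
  (approx_unit_tens tP totally_filter approx_unit_support_proj
    approx_unit_support_proj)
  (V := R[i]^o) (l := s) (l' := fun m => pair 1 (lact (s1 m) q))).
- by [].
- apply: strictly_continuous_comp (bounded_linear_pair 1) _.
  exact: strictly_continuous_strict.
- move=> a a'; rewrite sE s1E /= amulZl.
  by rewrite (linZ (bounded_linear_pair 1).1) q1 hE.
- exact: comul_bounded.
Qed.

(** * Slices of [delta (x) id] and [id (x) comul] *)

Section Pairing.
Variables (C : cstarAlgType R) (one : C) (oneP : is_unit one).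
Variables (CB : minTensor C B) (CBB : minTensor3 CB (bi_tens B)).

Let tP : is_cstar_tensor (tens CB) := (tensP CB).1.
Let t12P : is_cstar_tensor (tens12_3 CBB) := (tens12_3P CBB).1.
Let t1P : is_cstar_tensor (tens1_23 CBB) := (tens1_23P CBB).1.
Let bP : is_cstar_tensor (tens (bi_tens B)) := (tensP (bi_tens B)).1.

Let approx_unit_CB :=
  approx_unit_tens tP totally_filter (approx_unit_one oneP totally_filter)
    approx_unit_support_proj.

Lemma slice_eq_bounded (V : normedModType R[i]) (l l' : multiplier CB -> V) :
  strictly_continuous l -> strictly_continuous l' ->
  (forall c b, l (mult_of (tens CB c b)) = l' (mult_of (tens CB c b))) ->
  forall m, bounded_mult m -> l m = l' m.
Proof. exact: (strictly_continuous_eq tP totally_filter approx_unit_CB). Qed.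

Lemma slice_slice h k S S2 S' (c : C) (y : bi_tens B) :
  is_slice (tens CB) (pair h) S -> is_slice (tens12_3 CBB) (pair k) S2 ->
  is_slice (tens (bi_tens B)) (pair k) S' ->
  S (S2 (tens1_23 CBB c y)) = pair h (S' y) *: c.
Proof.
move=> [Sb SE] [S2b S2E] [S'b S'E]; move: y; apply: (bounded_linear_eq bP).
- apply: bounded_linear_comp Sb _; apply: bounded_linear_comp S2b _.
  exact: bounded_linear_tensr.
- apply: (bounded_linear_scaler (w := fun y => pair h (S' y))).
  exact: bounded_linear_comp (bounded_linear_pair h) S'b.
- move=> a b; rewrite -tens3A S2E (linZ Sb.1) SE S'E.
  by rewrite (linZ (bounded_linear_pair h).1) scalerA.
Qed.

(** Strict density reduces to [m = c (x) b], where reassociating the triple tensor turns the claim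
    into [pair_mulE]. *)
Lemma slice_comul h k S S2 Shk g q q' m :
  is_slice (tens CB) (pair h) S -> is_slice (tens12_3 CBB) (pair k) S2 ->
  is_slice (tens CB) (pair (h * k)) Shk ->
  is_id_tens_hom (tens1_23 CBB) comul g ->
  local_unit (pair h) q -> local_unit (pair k) q ->
  local_unit (pair (h * k)) q' -> bounded_mult m ->
  S (S2 (lact (g m) (tens12_3 CBB (tens CB one q) q))) =
  Shk (lact m (tens CB one q')).
Proof.
move=> SP S2P ShkP [[[lg _ _] gs] gE] hq kq [_ _ hkq'].
have [S' S'P] := pair_slice k bP.
move: m; apply: slice_eq_bounded.
- apply: strictly_continuous_comp SP.1 _; apply: strictly_continuous_comp S2P.1 _.
  exact: strictly_continuous_strict.
- by apply: strictly_continuous_comp ShkP.1 _; exact: strictly_continuous_lact.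
move=> c b; rewrite tens3A (gE c b one (tens (bi_tens B) q q)).1 /=.
rewrite (slice_slice _ _ SP S2P S'P) -(pair_mulE b S'P hq kq).
by rewrite (ct_mul tP) ShkP.2 hkq' !(oneP _).2.
Qed.

Lemma slice_hom_tens k S S2 f (d : C -> multiplier CB) q m z :
  is_slice (tens CB) (pair k) S -> is_slice (tens12_3 CBB) (pair k) S2 ->
  is_hom_tens_id (tens12_3 CBB) d f -> strict_hom d ->
  local_unit (pair k) q -> bounded_mult m ->
  S2 (lact (f m) (tens12_3 CBB z q)) = lact (d (S (lact m (tens CB one q)))) z.
Proof.
move=> SP S2P [[[lf _ _] fs] fE] dS [_ _ kq]; have [ld _ _] := dS.1.
move: m; apply: slice_eq_bounded.
- by apply: strictly_continuous_comp S2P.1 _; exact: strictly_continuous_strict.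
- have db : bounded_linear (fun c => lact (d c) z).
    apply: linear_continuous0_bounded; first by move=> l x y; rewrite ld.
    exact: strict_hom_cvg0.
  apply: strictly_continuous_comp db _; apply: strictly_continuous_comp SP.1 _.
  exact: strictly_continuous_lact.
move=> c b; rewrite (fE c b z q).1 /= S2P.2 kq (ct_mul tP) SP.2 kq.
by rewrite (oneP c).2 (linZ ld).
Qed.

End Pairing.
End DiscreteDual.

(** * The partial action *)

(** A factor [1 (x) q] inserted under [S] is central, so it moves past [z] and [z] splits off on the
    right. *)
Lemma slice_lact_tens (R : realType) (C B : cstarAlgType R) (one : C)
    (CB T3 : cstarAlgType R) (t : C -> B -> CB) (t3 : CB -> B -> T3)
    (w v : B -> R[i]) S S2 q n z :
  is_unit one -> is_cstar_tensor t -> is_cstar_tensor t3 ->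
  is_slice t w S -> is_slice t3 v S2 -> local_unit w q -> local_unit v q ->
  S (S2 (lact n (t3 z q))) = S (S2 (lact n (t3 (t one q) q)) ** z).
Proof.
move=> oneP tP t3P SP S2P wq vq; have [qC _ _] := wq.
rewrite -[LHS](oneP _).2 -(slice_amulr tP SP wq) -(slice_amulr t3P S2P vq).
rewrite -lact_amul (ct_mul t3P) -(unit_tens_central tP oneP qC) -(ct_mul t3P).
by rewrite lact_amul (slice_amulr t3P S2P vq).
Qed.

Theorem theorem5p1 (R : realType) (G : compactQG R)
    (H : hopfAlg R[i]) (e : H -> G) (He : is_matrix_Hopf_algebra e)
    (Ghat : cstarBialg R) (D : discrete_dual e Ghat)
    (C : cstarAlgType R) (oneC : C) (HoneC : is_unit oneC)
    (CG : minTensor C Ghat) (CGG : minTensor3 CG (bi_tens Ghat))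
    (delta : C -> multiplier CG)
    (Hdelta : partial_coaction CGG delta) (Hcounital : counital delta) :
  exists act : H -> C -> C,
    (forall v : H, exists s : multiplier CG -> multiplier C,
       is_id_slice (dd_pair D v) s /\
       forall c, s (delta c) = mult_of (act v c)) /\
    symmetric_partial_action (@amul R C) oneC act.
Proof.
have tP : is_cstar_tensor (tens CG) := (tensP CG).1.
have t3P : is_cstar_tensor (tens12_3 CGG) := (tens12_3P CGG).1.
have [dS _ [d' [f [g [p [[_ d'E] fP gP pP fg]]]]]] := Hdelta.
have [dlin dM dstar] := dS.1; have db := strict_hom_bounded dS.
have /choice[S SP] := fun h => pair_slice D h tP.
have /choice[S2 S2P] := fun h => pair_slice D h t3P.
have /choice[qq qqP] : forall h, exists q, local_unit (dd_pair D h) q.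
  by move=> h; have [q /(_ h (mem_head _ _))] := pair_local_unit D [:: h]; exists q.
pose act h c := S h (lact (delta c) (tens CG oneC (qq h))).
(* The chosen [qq h] may be replaced by any local unit, so one [q] can serve several functionals at
   once. *)
have actE h q c : local_unit (dd_pair D h) q ->
    act h c = S h (lact (delta c) (tens CG oneC q)).
  by move=> hq; apply: (slice_local_unit tP HoneC (SP h)).
have units h k : exists q, [/\ local_unit (dd_pair D h) q,
    local_unit (dd_pair D k) q &
    forall i, i \in hcomul h -> local_unit (dd_pair D i.1) q /\
                                local_unit (dd_pair D i.2) q].
  have [q qP] := pair_local_unit D
    (h :: k :: map fst (hcomul h) ++ map snd (hcomul h)).
  exists q; split=> [||i ih]; try by apply: qP; rewrite !inE eqxx ?orbT.
  by split; apply: qP; rewrite !inE mem_cat map_f ?orbT.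
(* As [C] is unital, the extension of [delta] takes at [mone C] the value [delta oneC]. *)
have {}pP : is_mtens (tens12_3 CGG) (delta oneC) (mone Ghat) p.
  by rewrite -d'E (unit_mult_of HoneC).
have [p' [p'P gf]] : exists p',
    is_mtens (tens12_3 CGG) (delta oneC) (mone Ghat) p' /\
    forall c, f (delta c) = g (delta c) ** p'.
  exists (star p); split.
    have := is_mtens_star t3P pP.
    rewrite -dstar (star_unit HoneC).
    have -> // : star (mone Ghat) = mone Ghat.
    by apply: multiplierP => x /=; rewrite starK.
  move=> c; have [[[_ _ fstar] _] _] := fP; have [[[_ _ gstar] _] _] := gP.
  by rewrite -[LHS]starK -fstar -dstar fg starM -gstar -dstar starK.
have Slact h q m x : local_unit (dd_pair D h) q ->
    (forall i, i \in hcomul h -> local_unit (dd_pair D i.1) q /\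
                                 local_unit (dd_pair D i.2) q) ->
    S h (lact m x) =
    \sum_(i <- hcomul h) S i.1 (lact m (tens CG oneC q)) ** S i.2 x.
  move=> hq iq; apply: (slice_lact_amul tP HoneC (SP h)
    (w1 := fun i => dd_pair D i.1) (w2 := fun i => dd_pair D i.2)
    (S1 := fun i => S i.1) (S2 := fun i => S i.2) _ _ _ hq) => //.
  - by move=> a b; exact: dd_pair_comul.
  - by move=> i /iq [].
have Smul h k c q : local_unit (dd_pair D h) q -> local_unit (dd_pair D k) q ->
    S h (S2 k (lact (g (delta c)) (tens12_3 CGG (tens CG oneC q) q))) =
    act (h * k) c.
  move=> hq kq.
  exact: (slice_comul HoneC (SP h) (S2P k) (SP (h * k)) gP hq kq (qqP _) (db c)).
have dact k c z q : local_unit (dd_pair D k) q ->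
    lact (delta (act k c)) z = S2 k (lact (f (delta c)) (tens12_3 CGG z q)).
  move=> kq; rewrite (actE k q) //.
  by rewrite (slice_hom_tens HoneC z (SP k) (S2P k) fP dS kq (db c)).
exists act; split.
  move=> v; exists (fun m => mult_of (S v (lact m (tens CG oneC (qq v))))).
  split=> //; split.
  - by move=> k m n; rewrite /= (SP v).1.1 linear_mult_of.
  - move=> F m FF Fb mb Fm a.
    have Sm : S v (lact n (tens CG oneC (qq v))) @[n --> F] -->
        S v (lact m (tens CG oneC (qq v))).
      exact: (bounded_linear_cvg FF (SP v).1 (Fm _).1).
    split.
      exact: (bounded_linear_cvg FF (bounded_linear_amulr a) Sm).
    exact: (bounded_linear_cvg FF (bounded_linear_amull a) Sm).
  - move=> c b /=; rewrite (ct_mul tP) (SP v).2 (HoneC c).2.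
    by have [_ _ ->] := qqP v.
split; [split|].
- split=> [c k g' h|h k c c']; last first.
    by rewrite /act dlin /= (SP h).1.1.
  have [q qP] := pair_local_unit D [:: k *: g' + h; g'; h].
  have [q1 q2 q3] : [/\ local_unit (dd_pair D (k *: g' + h)) q,
      local_unit (dd_pair D g') q & local_unit (dd_pair D h) q].
    by split; apply: qP; rewrite !inE eqxx ?orbT.
  rewrite (actE _ q) // (actE g' q) // (actE h q) //.
  apply: (sliceZD tP (SP g') (SP h)).
  have -> : (fun b => k * dd_pair D g' b + dd_pair D h b) =
      dd_pair D (k *: g' + h).
    by apply/funext => b; rewrite dd_pair_linear.
  exact: SP.
(* The counit in [Hcounital] is [pair 1], so its slice agrees with that of [1] on [delta c]. *)
- move=> c; have [w [wc [s [[ls ss sE] sd]]]] := Hcounital.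
  have w1 : w = dd_pair D 1 := counit_eq D wc.
  rewrite -[RHS](HoneC c).2 -[RHS]/(lact (mult_of c) oneC) -sd.
  have [q [q1 _ _]] := units 1 1; rewrite (actE 1 q) //.
  apply: (slice_eq_bounded D HoneC
    (l := fun m => S 1 (lact m (tens CG oneC q)))
    (l' := fun m => lact (s m) oneC) _ _ _ (db c)).
  - by apply: strictly_continuous_comp (SP 1).1 _; exact: strictly_continuous_lact.
  - exact: strictly_continuous_strict.
  - move=> a b; rewrite sE /= (ct_mul tP) (SP 1).2 !(HoneC _).2 w1.
    by have [_ _ ->] := q1.
- move=> h c d; have [q [hq _ iq]] := units h h.
  rewrite (actE h q) // dM /= (Slact _ q) //.
  by apply: eq_big_seq => i /iq[i1 i2]; rewrite (actE _ q) // (actE _ q).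
- move=> h k c; have [q [hq kq iq]] := units h k.
  (* On the left, [p] passes through the outer slice as [delta oneC], a multiplier that the
     coproduct of [h] then splits off. *)
  rewrite (actE h q) // (dact _ _ _ q) // fg /= (slice_mtens t3P (S2P k) kq _ pP).
  rewrite (Slact _ q) //; apply: eq_big_seq => i /iq[i1 i2].
  by rewrite (Smul _ _ _ _ i2 kq) (actE i.1 q).
- move=> h k c; have [q [hq kq iq]] := units h k.
  (* On the right, [p'] acts first and turns the test vector into [delta(1) (1 (x) q)], which
     becomes the right factor. *)
  rewrite (actE h q) // (dact _ _ _ q) // gf /= (p'P _ _).1 /=.
  rewrite (slice_lact_tens _ _ HoneC tP t3P (SP h) (S2P k) hq kq).
  rewrite (slice_amul tP (SP h) (fun i => SP i.1) (fun i => SP i.2)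
    (dd_pair_comul D h)).
  apply: eq_big_seq => i /iq[i1 i2].
  by rewrite (Smul _ _ _ _ i1 kq) (actE i.2 q).
Qed.
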